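(* Fix integers $r\ge1$, $g\ge1$, $n\ge1$, non-negative integers $m_2,\dots,m_n$ and $a_2,\dots,a_n\in\{0,\dots,r\}$, and for $j\ge 0$ and $d\in\mathbb Z$ let $b_j,e_j,k(d),\delta$ be as defined in the context. Fix any $N\ge1$, and let $V^{(N)}=(V^{(N)}_{d,j})_{d\ge\delta,\,0\le j<N}$ be the matrix with entries $$V^{(N)}_{d,j}=\sum_{p=0}^{k(d)+1}\sum_e(-1)^{1-a-(d-e)(r+1)}\Big[\tfrac{3-r}2-(d-e)(r+1)\Big]^{k(d)}_p(R^p)_a{}^b\;\langle\tau_\bullet(T^a)\rangle_{0,d-e}\;\langle\tau_\bullet(T_b)\,T^{b_j}\rangle^{N-1-j}_{e-e_j},$$ where $e$ runs over the integers and the indices $a,b$ are summed over $0,\dots,r$. Then any $N\times N$ submatrix of $V^{(N)}$, obtained by picking $N$ distinct values of $d$, has non-zero determinant.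
   Context: Indices: for $j\ge0$, the integers $b_j,e_j$ with $0\le b_j\le r$ are uniquely determined by $(r+1)e_j+(r-3)(1-g)+n=j+b_j+\sum_{i=2}^n(m_i+a_i)$. For an integer $d$, $k(d)=d(r+1)+(r-3)(1-g)+n-1-\sum_{i=2}^n(m_i+a_i)$, and $\delta$ is the smallest $d$ with $k(d)>0$. $X=\mathbb P^r$; $T_a$ ($0\le a\le r$) is the class of a linear subspace of codimension $a$ and $T^a=T_{r-a}$ is the Poincaré-dual basis. $R$ is multiplication by $c_1(X)$, so $(R^p)_a{}^b=(r+1)^p\delta_{a+p,b}$. $[x]^k_p$ is the $z^p$-coefficient of $\prod_{j=0}^k(z+x+j)$. Genus-$0$ Gromov-Witten invariants $\langle\tau_{l_1}(\gamma_1)\cdots\tau_{l_s}(\gamma_s)\rangle_{0,f}=\int_{[\bar M_{0,s}(\mathbb P^r,f)]^{\rm virt}}\prod_i\psi_{x_i}^{l_i}ev_{x_i}^*\gamma_i$ (with $\psi_{x_i}$ the cotangent line class at the $i$-th marked point, $ev_{x_i}$ evaluation, $\tau_0(\gamma)$ abbreviated $\gamma$), zero unless $\sum_i(l_i+\deg\gamma_i)=(r+1)f+r-3+s$, and zero for $f<0$. Convention: the indices $l_i$ may be any integers; invariants containing some negative $l_i$ are zero, except (i) $\langle\tau_{-2}(\mathrm{pt})\rangle_{0,0}=1$; (ii) $\langle\tau_{l_1}(\gamma_1)\tau_{l_2}(\gamma_2)\rangle_{0,0}=(-1)^{\max(l_1,l_2)}(\gamma_1\cdot\gamma_2)\,\delta_{l_1+l_2,-1}$.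 Auxiliary two-point numbers $\langle\tau_l(\gamma_1)\gamma_2\rangle^i_f$ ($i\ge0$): $\langle\tau_l(\gamma_1)\gamma_2\rangle^0_f=\langle\tau_l(\gamma_1)\gamma_2\rangle_{0,f}$; for $i\ge1$, $l\ge0$, $$\langle\tau_l(\gamma_1)\gamma_2\rangle^i_f=\langle\tau_{l+1}(\gamma_1)\gamma_2\rangle^{i-1}_f-\sum_{f_1+f_2=f}\langle\tau_l(\gamma_1)T_a\rangle_{0,f_1}\langle T^a\gamma_2\rangle^{i-1}_{f_2}$$ (sum over $a$); for $l<0$ they are zero except $\langle\tau_{-i-1}(\gamma_1)\gamma_2\rangle^i_0=(\gamma_1\cdot\gamma_2)$. A dot in $\tau_\bullet$ denotes the uniquely determined integer for which the invariant satisfies its dimension condition; for $\langle\tau_l(\gamma_1)\gamma_2\rangle^i_f$ this condition is $l+i+\deg\gamma_1+\deg\gamma_2=(r+1)f+r-1$. *)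

(* Defs.v *)
From HB Require Import structures.
From mathcomp Require Import all_boot all_order all_algebra.
From mathcomp Require Import boolp classical_sets functions cardinality fsbigop.

Set Implicit Arguments.
Unset Strict Implicit.
Unset Printing Implicit Defensive.

Import Order.TTheory GRing.Theory Num.Theory.
Local Open Scope ring_scope.

(* Moduli spaces of stable maps are not available in the libraries.  The
   cohomological data of the spaces Mbar_{0,I}(P^r, f) (I a finite set of labels
   of the marked points, f >= 0 the degree) is therefore a parameter:
     coh I f       even rational cohomology of Mbar_{0,I}(P^r, f);
     integral      integration over the virtual fundamental class (for P^r in
                   genus 0 this is the usual fundamental class);
     psi x         cotangent line class at the marked point x;
     evH x         ev_x^* H, with H the hyperplane class of P^r;
     pull          pull-back along the map Mbar_{0, option I} -> Mbar_{0, I}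
                   which forgets the additional marked point None;
     bdry A f1     class of the boundary divisor D(A, f1 | ~: A, f - f1): curves
                   with two components, one of degree f1 with the points of A
                   and one of degree f - f1 with the other points (0 if empty).
   If Mbar_{0,I}(P^r, f) is empty (f = 0 and #|I| < 3), coh I f is a junk ring
   on which the integral vanishes. *)
Record moduli_data := ModuliData {
  coh : finType -> nat -> comAlgType rat;
  integral : forall (I : finType) (f : nat), {scalar coh I f};
  psi : forall (I : finType) (f : nat), I -> coh I f;
  evH : forall (I : finType) (f : nat), I -> coh I f;
  pull : forall (I : finType) (f : nat),
    {lrmorphism coh I f -> coh (option I) f};
  bdry : forall (I : finType) (f : nat), {set I} -> 'I_f.+1 -> coh I f
}.

Section Geometry.
Variables (r : nat) (M : moduli_data).

Definition stable (I : finType) (f : nat) : bool := (0 < f)%N || (2 < #|I|)%N.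

(* T_a is the class H^a of a codimension a linear subspace. *)
Definition insertion (I : finType) (f : nat) (l a : I -> nat) : coh M I f :=
  \prod_(x : I) (psi M f x ^+ l x * evH M f x ^+ a x).

(* The locus where the points Some i and None lie on a contracted component,
   i.e. the image of the i-th section of the forgetful map. *)
Definition section_divisor (I : finType) (f : nat) (i : I) : coh M (option I) f :=
  bdry M [set Some i; None] (ord0 : 'I_f.+1).

(* Extension of exponents on A to A plus the node None, where the node carries
   no psi class and the power c of evH. *)
Definition with_node (I : finType) (A : {set I}) (l : I -> nat) (c : nat)
    (x : option {y : I | y \in A}) : nat :=
  if x is Some y then l (val y) else c.

(* These properties hold for the actual spaces Mbar_{0,I}(P^r, f), and they
   determine all one- and two-point integrals of psi and ev classes: they give
   the string and divisor equations and the topological recursion relation. *)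
Record stable_maps_axioms : Prop := StableMapsAxioms {
  evH_nilpotent : forall (I : finType) (f : nat) (i : I),
    evH M f i ^+ r.+1 = 0;

  (* Mbar_{0,I}(P^r, f) has dimension (r+1) f + r - 3 + #|I|. *)
  integral_dimension : forall (I : finType) (f : nat) (l a : I -> nat),
    (\sum_(i : I) (l i + a i) + 3 != r.+1 * f + r + #|I|)%N ->
    integral M I f (insertion f l a) = 0;

  integral_unstable : forall (I : finType) (f : nat) (u : coh M I f),
    ~~ stable I f -> integral M I f u = 0;

  integral_relabel : forall (I J : finType) (s : I -> J) (f : nat)
      (l a : J -> nat),
    bijective s ->
    integral M I f (insertion f (l \o s) (a \o s))
      = integral M J f (insertion f l a);

  (* Mbar_{0,3}(P^r, 0) = P^r, all evaluation maps being the identity. *)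
  integral_constant_maps : forall (I : finType) (a : I -> nat),
    #|I| = 3 -> (\sum_(i : I) a i)%N = r ->
    integral M I 0 (insertion 0 (fun=> 0%N) a) = 1;

  (* There is exactly one line through two general points. *)
  integral_line : forall (I : finType),
    #|I| = 2 -> integral M I 1 (insertion 1 (fun=> 0%N) (fun=> r)) = 1;

  pull_evH : forall (I : finType) (f : nat) (i : I),
    stable I f -> pull M I f (evH M f i) = evH M f (Some i);

  pull_psi : forall (I : finType) (f : nat) (i : I),
    stable I f ->
    psi M f (Some i) = pull M I f (psi M f i) + section_divisor f i;

  section_psi : forall (I : finType) (f : nat) (i : I),
    stable I f -> psi M f (Some i) * section_divisor f i = 0;

  section_disjoint : forall (I : finType) (f : nat) (i j : I),
    stable I f -> i != j -> section_divisor f i * section_divisor f j = 0;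

  section_evH : forall (I : finType) (f : nat) (i : I),
    stable I f ->
    evH M f None * section_divisor f i = evH M f (Some i) * section_divisor f i;

  integral_section : forall (I : finType) (f : nat) (i : I) (u : coh M I f),
    stable I f ->
    integral M (option I) f (pull M I f u * section_divisor f i)
      = integral M I f u;

  integral_pull : forall (I : finType) (f : nat) (u : coh M I f),
    stable I f -> integral M (option I) f (pull M I f u) = 0;

  (* A degree f curve meets a hyperplane in f points. *)
  integral_pull_evH : forall (I : finType) (f : nat) (u : coh M I f),
    stable I f ->
    integral M (option I) f (pull M I f u * evH M f None)
      = f%:R * integral M I f u;

  (* psi_i is the divisor of curves with i separated from j and k. *)
  psi_boundary : forall (I : finType) (f : nat) (i j k : I),
    i != j -> i != k -> j != k ->
    psi M f i = \sum_(A : {set I} | [&& i \in A, j \notin A & k \notin A])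
                  \sum_(f1 < f.+1) bdry M A f1;

  (* D(A, f1 | ~: A, f - f1) is the fibre product over P^r of the moduli spaces
     of its two components, glued at the node. *)
  integral_boundary : forall (I : finType) (f : nat) (A : {set I})
      (f1 : 'I_f.+1) (l a : I -> nat),
    (0 < #|I|)%N ->
    integral M I f (bdry M A f1 * insertion f l a)
      = \sum_(c < r.+1)
          integral M (option {y : I | y \in A}) f1
            (insertion f1 (@with_node I A l 0) (@with_node I A a c))
        * integral M (option {y : I | y \in ~: A}) (f - f1)%N
            (insertion (f - f1)%N (@with_node I (~: A) l 0)
                       (@with_node I (~: A) a (r - c)))
}.

(* <tau_{l_1}(T_{a_1}) ... tau_{l_s}(T_{a_s})>_{0,f} for the list of the pairs
   (l_i, a_i), with the conventions for negative f and negative l_i. *)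
Definition gw (f : int) (s : seq (int * 'I_r.+1)) : rat :=
  if f < 0 then 0
  else if all (fun la => 0 <= la.1) s then
    integral M 'I_(size s) `|f|%N
      (insertion `|f|%N
        (fun i : 'I_(size s) => `|(nth (0%:Z, ord0) s i).1|%N)
        (fun i : 'I_(size s) => nat_of_ord (nth (0%:Z, ord0) s i).2))
  else if f != 0 then 0
  else match s with
       | [:: (l, a)] => ((l == - 2%:Z) && (a == r :> nat))%:R
       | [:: (l1, a1); (l2, a2)] =>
           (-1) ^ (Num.max l1 l2) * (a1 + a2 == r)%N%:R
             * (l1 + l2 == - 1%:Z)%:R
       | _ => 0
       end.

(* T^a = T_(r-a) *)
Definition dual (a : 'I_r.+1) : 'I_r.+1 := rev_ord a.

(* gw2 i l a b f = <tau_l(T_a) T_b>^i_f *)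
Fixpoint gw2 (i : nat) (l : int) (a b : 'I_r.+1) (f : int) : rat :=
  if i is i'.+1 then
    if 0 <= l then
      gw2 i' (l + 1) a b f
      - \sum_(f1 \in [set: int]) \sum_(c < r.+1)
          gw f1 [:: (l, a); (0, c)] * gw2 i' 0 (dual c) b (f - f1)
    else ((l == - i%:Z - 1) && (f == 0) && (a + b == r)%N)%:R
  else gw f [:: (l, a); (0, b)].

(* <tau_.(T_a)>_{0,f} and <tau_.(T_a) T_b>^i_f, the dot being determined by the
   dimension condition. *)
Definition gw1_dot (a : 'I_r.+1) (f : int) : rat :=
  gw f [:: (r.+1%:Z * f + r%:Z - 2%:Z - a%:Z, a)].

Definition gw2_dot (i : nat) (a b : 'I_r.+1) (f : int) : rat :=
  gw2 i (r.+1%:Z * f + r%:Z - 1 - i%:Z - a%:Z - b%:Z) a b f.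

End Geometry.

(* [x]^k_p *)
Definition bracket (x : rat) (k p : nat) : rat :=
  (\prod_(j < k.+1) ('X + (x + j%:R)%:P) : {poly rat})`_p.

(* (R^p)_a^b *)
Definition Rpow (r p : nat) (a b : 'I_r.+1) : rat :=
  r.+1%:R ^+ p * (a + p == b)%N%:R.

Definition kdeg (r g n : nat) (m a : nat -> nat) (d : int) : int :=
  d * r.+1%:Z + (r%:Z - 3%:Z) * (1 - g%:Z) + n%:Z - 1
    - (\sum_(2 <= i < n.+1) (m i + a i))%N%:Z.

Definition is_delta (r g n : nat) (m a : nat -> nat) (delta : int) : Prop :=
  0 < kdeg r g n m a delta /\
  forall d : int, 0 < kdeg r g n m a d -> delta <= d.

Definition is_be (r g n : nat) (m a : nat -> nat)
    (b : nat -> 'I_r.+1) (e : nat -> int) : Prop :=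
  forall j : nat,
    r.+1%:Z * e j + (r%:Z - 3%:Z) * (1 - g%:Z) + n%:Z
      = j%:Z + (b j)%:Z + (\sum_(2 <= i < n.+1) (m i + a i))%N%:Z.

(* The absolute value of kdeg is harmless: V is only used for d >= delta, where
   kdeg is positive. *)
Definition Vcoef (r : nat) (M : moduli_data) (g n : nat) (m a : nat -> nat)
    (b : nat -> 'I_r.+1) (e : nat -> int) (N : nat) (d : int) (j : nat) : rat :=
  let k := `|kdeg r g n m a d|%N in
  \sum_(p < k.+2) \sum_(x \in [set: int]) \sum_(u < r.+1) \sum_(v < r.+1)
    (-1) ^ (1 - u%:Z - (d - x) * r.+1%:Z)
    * bracket ((3%:R - r%:R) / 2%:R - (d - x)%:~R * r.+1%:R) k p
    * Rpow p u v
    * gw1_dot M (dual u) (d - x)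
    * gw2_dot M (N - 1 - j)%N v (dual (b j)) (x - e j).

(* Main.v *)
Require Import Defs.
From mathcomp Require Import all_boot all_order all_algebra.
From mathcomp Require Import boolp classical_sets functions cardinality fsbigop.
From mathcomp Require Import zify ring.
Set Implicit Arguments.
Unset Strict Implicit.
Unset Printing Implicit Defensive.
Import Order.TTheory GRing.Theory Num.Theory.
Local Open Scope ring_scope.

(* The corrected numbers <..>^i are the columns of the fundamental solution
   truncated by Birkhoff factorization; unwinding their recursion multiplies
   V on the right by a unitriangular matrix and replaces them by honest
   two-point invariants.  The divisor equation and the topological recursion
   relation give the generating functions of the latter: modulo X^(r+1),
     sum_w <tau(T_(r-w)) T_b>_f X^w = (X+f)^b / prod_(i=1..f) (X+i)^(r+1),
   and, by the string equation, the case b = 0 also gives the one-point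
   invariants.  Put e_0 = 0.  Then the sum over e in V_(d,j) is, up to sign, the
   sum of the residues at Y = 0, ..., d of the rational function
     prod_(i=0..k) ((r+1)(Y-d) + (3-r)/2 + i) P_j(Y) / prod_(l=0..d) (Y-l)^(r+1)
   with P_j = Y^(r-b_0) prod_(i<j) (Y-e_i), so it is the coefficient of 1/Y at
   infinity.  Comparing d+1 with d, this coefficient divided by (r+1)^(k+1) is a
   polynomial in d of degree exactly j: the ratio of the two rational functions
   is 1 + (3/2)/Y + ..., and the positivity of 3/2 prevents any cancellation of
   leading coefficients.  A Vandermonde determinant concludes. *)

(** * Genus 0 invariants *)

Section GromovWitten.
Variables (r : nat) (M : moduli_data).
Hypothesis hr : (1 <= r)%N.
Hypothesis hM : stable_maps_axioms r M.

Lemma eq_insertion (I : finType) f (l l' a a' : I -> nat) :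
  l =1 l' -> a =1 a' -> insertion M f l a = insertion M f l' a'.
Proof. by move=> el ea; apply: eq_bigr => x _; rewrite el ea. Qed.

Lemma insertion_evH_nilpotent (I : finType) f (l a : I -> nat) i :
  (r < a i)%N -> insertion M f l a = 0.
Proof.
move=> ri; rewrite /insertion (bigD1 i) //=.
by rewrite -(subnKC ri) exprD (evH_nilpotent hM) mul0r mulr0 mul0r.
Qed.

(** * One-point and two-point integrals, string and divisor equations *)

Definition one_point f l a : rat :=
  integral M unit f (insertion M f (fun=> l) (fun=> a)).

Definition two_point f l a b : rat :=
  integral M bool f (insertion M f (fun x => if x then l else 0%N)
                                   (fun x => if x then a else b)).

Lemma gw_one_point f (l : nat) (a : 'I_r.+1) :
  gw M f%:Z [:: (l%:Z, a)] = one_point f l a.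
Proof.
rewrite /gw ltz_nat ltn0 /=.
rewrite /one_point.
have bs : bijective (fun _ : 'I_1 => tt).
  by exists (fun=> ord0) => [x|[]] //; apply/val_inj; case: x => [[]].
rewrite -(integral_relabel hM f _ _ bs).
by congr (integral M _ _ _); apply: eq_insertion => i; rewrite ord1.
Qed.

Lemma gw_two_point f (l : nat) (a b : 'I_r.+1) :
  gw M f%:Z [:: (l%:Z, a); (0, b)] = two_point f l a b.
Proof.
rewrite /gw ltz_nat ltn0 /=.
have bs : bijective (fun i : 'I_2 => i == ord0).
  exists (fun x => if x then ord0 else ord_max) => [x|[]] //.
  by apply/val_inj; case: x => [[|[|m]] Hm].
rewrite /two_point -(integral_relabel hM f _ _ bs).
congr (integral M _ _ _); apply: eq_insertion => i /=;
 by case: i => [[|[|m]] Hm].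
Qed.

Lemma two_point_evH_nilpotent f l a b :
  (r < a)%N || (r < b)%N -> two_point f l a b = 0.
Proof.
rewrite /two_point; case/orP => h.
  by rewrite (@insertion_evH_nilpotent _ _ _ _ true) // linear0.
by rewrite (@insertion_evH_nilpotent _ _ _ _ false) // linear0.
Qed.

Lemma two_point_dimension f l a b :
  (l + a + b + 1 != r.+1 * f + r)%N -> two_point f l a b = 0.
Proof.
move=> h; apply: (integral_dimension hM).
rewrite big_bool card_bool /=; move: h; apply: contraNN => /eqP h; apply/eqP; lia.
Qed.

Lemma two_point_deg0 l a b : two_point 0 l a b = 0.
Proof. by apply: (integral_unstable hM); rewrite /stable card_bool. Qed.

Lemma two_point_line : two_point 1 0 r r = 1.
Proof.
rewrite -(integral_line hM card_bool); congr (integral M _ _ _).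
by apply: eq_insertion => -[].
Qed.

(** Since psi at [Some i] annihilates the section divisor, multiplying the formula for one exponent
    by psi kills its divisor term, and the factor psi only has to be expanded once more. *)
Lemma psi_pull (I : finType) f (i : I) l : stable I f ->
  psi M f (Some i) ^+ l.+1
    = pull M I f (psi M f i ^+ l.+1)
      + pull M I f (psi M f i ^+ l) * section_divisor M f i.
Proof.
move=> st; rewrite !rmorphXn /=.
elim: l => [|l IH].
  by rewrite !expr1 expr0 mul1r (pull_psi hM).
rewrite exprS {}IH mulrDr.
rewrite [_ * (_ * section_divisor _ _ _)]mulrCA (section_psi hM) // mulr0 addr0.
by rewrite (pull_psi hM) // mulrDl -exprS [section_divisor _ _ _ * _]mulrC.
Qed.

Lemma prod_option (R : comPzSemiRingType) (I : finType) (F : option I -> R) :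
  \prod_x F x = F None * \prod_(x : I) F (Some x).
Proof.
rewrite (bigD1 None) //=; congr (_ * _).
by rewrite (reindex_omap Some id) => [|[x|]] //=; apply: eq_bigl => x; rewrite eqxx.
Qed.

Lemma prod_unit (R : comPzSemiRingType) (F : unit -> R) : \prod_x F x = F tt.
Proof. by rewrite (big_pred1 tt) // => -[]. Qed.

(** The point carrying the unit class is the one forgotten: the pulled-back part of psi^(l+1)
    integrates to 0, and the section part has lost one psi. *)
Lemma string_equation f l a : (0 < f)%N ->
  two_point f l.+1 a 0 = one_point f l a.
Proof.
move=> f0.
have st : stable unit f by rewrite /stable f0.
have bs : bijective (fun x : option unit => x != None).
  by exists (fun x : bool => if x then Some tt else None) => [[[]|]|[]].
rewrite /two_point -(integral_relabel hM f _ _ bs) /insertion.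
rewrite prod_option prod_unit /= !expr0 !mul1r /one_point /insertion prod_unit.
rewrite psi_pull // -(pull_evH hM) // -rmorphXn mulrDl mulrAC -!rmorphM linearD.
by rewrite (integral_pull hM) // add0r (integral_section hM).
Qed.

(* [None] carries the hyperplane class, so that it can be forgotten. *)
Definition divisor_point f l a b : rat :=
  integral M (option bool) f (insertion M f
    (fun x => if x is Some true then l else 0%N)
    (fun x => if x is Some y then if y then a else b else 1%N)).

Lemma divisor_equation0 f a b : (0 < f)%N ->
  divisor_point f 0 a b = f%:R * two_point f 0 a b.
Proof.
move=> f0.
have st : stable bool f by rewrite /stable f0.
rewrite /divisor_point /insertion prod_option /= expr0 mul1r expr1.
rewrite mulrC -(integral_pull_evH hM) //; congr (integral M _ _ (_ * _)).
rewrite !big_bool /= !expr0 !mul1r /insertion big_bool /=.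
by rewrite !rmorphM /= !rmorphXn /= !(pull_evH hM) // !expr0 !mul1r.
Qed.

(** The pulled-back part of psi^(l+1) meets the hyperplane class in f points. On the section divisor
    that class agrees with [evH] at [true], which raises the exponent a. *)
Lemma divisor_equation f l a b : (0 < f)%N ->
  divisor_point f l.+1 a b = f%:R * two_point f l.+1 a b + two_point f l a.+1 b.
Proof.
move=> f0.
have st : stable bool f by rewrite /stable f0.
rewrite /divisor_point /insertion prod_option /= expr0 mul1r expr1.
rewrite !big_bool /= psi_pull // expr0 mul1r -!(pull_evH hM) // -!rmorphXn.
rewrite !mulrDl mulrDr linearD -!rmorphM mulrC (integral_pull_evH hM) //.
congr (_ * _ + _).
  by congr (integral M _ _ _); rewrite /insertion big_bool /= expr0 mul1r.
rewrite -[two_point f l a.+1 b](integral_section hM true) //; congr (integral M _ _ _).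
rewrite /insertion big_bool /= expr0 mul1r exprS !rmorphM /= (pull_evH hM) //.
set D := section_divisor M f true; set A := pull _ _ _ _.
set B := pull _ _ _ _; set C := pull _ _ _ _.
have -> : evH M f None * (A * D * B * C) = (evH M f None * D) * (A * B * C) by ring.
by rewrite (section_evH hM) //; rewrite -/D; ring.
Qed.

Lemma divisor_point_deg0 a b : (a <= r)%N -> (b <= r)%N ->
  divisor_point 0 0 a b = (a + b.+1 == r)%N%:R.
Proof.
move=> ar br; rewrite /divisor_point.
have card3 : #|{: option bool}| = 3 by rewrite card_option card_bool.
have sum3 : (\sum_(x : option bool) (if x is Some y then if y then a else b else 1))%N
   = (a + b.+1)%N.
  rewrite (bigD1 None) //= (bigD1 (Some true)) //= (bigD1 (Some false)) //=.
  rewrite big_pred0; first by lia.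
  by move=> [[]|].
case: eqP => h.
  rewrite -[RHS](integral_constant_maps hM card3 (etrans sum3 h)).
  by congr (integral M _ _ _); apply: eq_insertion => // -[[]|].
apply: (integral_dimension hM); rewrite big_split /= sum3 card3.
rewrite big1 => [|[[]|]] //; apply/eqP; lia.
Qed.

(* With [psi] at [Some true] separated from the two other points, only the
   divisors with A = {Some true} contribute. *)
Lemma divisor_point_boundary f l a b :
  divisor_point f l.+1 a b
    = \sum_(f1 < f.+1) \sum_(c < r.+1)
        two_point f1 l a c * divisor_point (f - f1) 0 (r - c) b.
Proof.
rewrite /divisor_point.
set L := fun x : option bool => if x is Some true then l else 0%N.
set A := fun x : option bool => if x is Some y then if y then a else b else 1%N.
have -> : insertion M f (fun x => if x is Some true then l.+1 else 0%N) A
   = psi M f (Some true) * insertion M f L A.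
  rewrite /insertion (bigD1 (Some true)) //= [in RHS](bigD1 (Some true)) //=.
  rewrite exprS -!mulrA; congr (_ * (_ * (_ * _))).
  by apply: eq_bigr => -[[]|].
rewrite (@psi_boundary _ _ hM _ _ (Some true) (Some false) None) //.
rewrite (big_pred1 [set Some true]); last first.
  move=> S; apply/idP/eqP => [/and3P[h1 h2 h3]|->]; last by rewrite !inE.
  apply/setP => x; rewrite inE; case: x => [[]|] /=; first by rewrite h1.
    by rewrite (negbTE h2).
  by rewrite (negbTE h3).
rewrite mulr_suml linear_sum; apply: eq_bigr => f1 _.
rewrite (integral_boundary hM); last by rewrite card_option card_bool.
apply: eq_bigr => c _; congr (_ * _).
  have Sin : Some true \in [set Some true : option bool] by rewrite inE.
  pose s (x : bool) : option {y : option bool | y \in [set Some true : option bool]} :=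
    if x then Some (exist _ (Some true) Sin) else None.
  have bs : bijective s.
    exists (fun x => x != None) => [[]|[[y hy]|]] //=.
    rewrite /s; congr Some; apply: val_inj => /=.
    by move: hy; rewrite inE => /eqP ->.
  rewrite -(integral_relabel hM _ _ _ bs).
  by congr (integral M _ _ _); apply: eq_insertion => -[].
have Fin : Some false \in ~: [set Some true : option bool] by rewrite !inE.
have Nin : None \in ~: [set Some true : option bool] by rewrite !inE.
pose s (x : option bool) : option {y : option bool | y \in ~: [set Some true : option bool]} :=
  if x is Some y then if y then None else Some (exist _ (Some false) Fin)
  else Some (exist _ None Nin).
have bs : bijective s.
  exists (fun x => if x is Some y then if val y is Some _ then Some false else None
                   else Some true) => [[[]|]|[[y hy]|]] //=.
  case: y hy => [[]|] hy /=; first by exfalso; move: hy; rewrite !inE eqxx.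
    by congr Some; apply: val_inj.
  by congr Some; apply: val_inj.
rewrite -(integral_relabel hM _ _ _ bs).
by congr (integral M _ _ _); apply: eq_insertion => -[[]|].
Qed.

(** The divisor equation computes one side, the boundary splitting the other. The component without
    psi classes has dimension condition b + 1 = (r+1)g + c in degree g, so with b <= r it either is
    constant with c = b + 1, or has degree 1 with c = 0 and b = r. *)
Lemma two_point_topological_recursion f l a b : (b <= r)%N ->
  f.+1%:R * two_point f.+1 l.+1 a b + two_point f.+1 l a.+1 b
    = two_point f.+1 l a b.+1 + (b == r)%:R * two_point f l a 0.
Proof.
move=> br; rewrite -divisor_equation // divisor_point_boundary.
have big_degree g c : (c <= r)%N -> (r.+1 * g + c != b.+1)%N -> (0 < g)%N ->
  divisor_point g 0 (r - c) b = 0.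
  move=> cr h g0; rewrite divisor_equation0 // two_point_dimension ?mulr0 //.
  by apply: contraNN h => /eqP h; apply/eqP; lia.
(* The last summand is the one whose second component is constant. *)
rewrite big_ord_recr /= subnn addrC; congr (_ + _).
  case: (ltnP b r) => hb.
    have hb1 : (b.+1 < r.+1)%N by lia.
    rewrite (bigD1 (Ordinal hb1)) //= big1 => [|c cb]; last first.
      rewrite divisor_point_deg0 ?leq_subr //; case: eqP => [h|_]; last by rewrite mulr0.
      case/eqP: cb; apply: val_inj => /=; have := ltn_ord c; lia.
    rewrite divisor_point_deg0 ?leq_subr // (_ : _ == _) ?mulr1 ?addr0 //.
    by apply/eqP; lia.
  rewrite big1 => [|c _]; first by rewrite two_point_evH_nilpotent // ltnS hb orbT.
  rewrite divisor_point_deg0 ?leq_subr //; case: eqP => [|_]; last by rewrite mulr0.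
  have := ltn_ord c; lia.
(* The next summand has a second component of degree 1; all remaining degrees are too large. *)
rewrite big_ord_recr /= subSnn big1 ?add0r => [|f1 _]; last first.
  apply: big1 => c _; rewrite big_degree ?mulr0 //.
  - by rewrite -ltnS.
  - have := ltn_ord f1; have := ltn_ord c; nia.
  - have := ltn_ord f1; lia.
rewrite big_ord_recl /= big1 ?addr0 => [|c _]; last first.
  by have := ltn_ord c; rewrite big_degree ?mulr0 //= /bump; lia.
case: eqP => [->|h]; last by rewrite big_degree ?mulr0 ?mul0r //; nia.
by rewrite subn0 divisor_equation0 // two_point_line mulr1 mulrC.
Qed.

(* In degree 0 only the conventional value, with index -1, survives. *)
Definition two_point_dot (f v b : nat) : rat :=
  if f is 0 then (v + b == r)%N%:R else two_point f (r.+1 * f + r - 1 - v - b) v b.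

(** The conventional values in degree 0 extend the topological recursion to the cases without a psi
    class to remove: degree 0, and the line through two points, where both sides are 1. *)
Lemma two_point_dot_rec f v b : (v <= r)%N -> (b <= r)%N ->
  f%:R * two_point_dot f v b + two_point_dot f v.+1 b
    = two_point_dot f v b.+1
      + (b == r)%:R * (if f is f'.+1 then two_point_dot f' v 0 else 0).
Proof.
move=> vr br; case: f => [|f] /=.
  by rewrite mul0r add0r mulr0 addr0 addnS addSn.
have [/and3P[/eqP-> /eqP-> /eqP->]|hneq] := boolP [&& f == 0, v == r & b == r]%N.
  rewrite eqxx /two_point_dot addn0 eqxx (_ : (_ - _ - _ = 0)%N); last by lia.
  rewrite two_point_line two_point_evH_nilpotent ?ltnSn //.
  by rewrite [in RHS]two_point_evH_nilpotent ?ltnSn ?orbT // addr0 add0r.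
have [l lE] : exists l, (r.+1 * f.+1 + r - 1 - v - b = l.+1)%N.
  exists (r.+1 * f.+1 + r - 2 - v - b)%N; move: hneq.
  by rewrite !negb_and => /or3P[] h; nia.
have -> : (r.+1 * f.+1 + r - 1 - v.+1 - b = l)%N by lia.
have -> : (r.+1 * f.+1 + r - 1 - v - b.+1 = l)%N by lia.
rewrite lE two_point_topological_recursion //; congr (_ + _).
case: eqP => [bE|]; rewrite ?mul0r // !mul1r.
case: f lE hneq => [|f] lE hneq; last by rewrite /two_point_dot; congr two_point; nia.
rewrite two_point_deg0 /= addn0; case: eqP => // vE.
by move: hneq; rewrite vE bE !eqxx.
Qed.

Lemma gw2_dot0E f (v b : 'I_r.+1) : gw2_dot M 0 v b f%:Z = two_point_dot f v b.
Proof.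
have := ltn_ord v; have := ltn_ord b; rewrite !ltnS => br vr.
rewrite /gw2_dot /=; case: f => [|f].
  rewrite /two_point_dot mulr0 add0r subr0.
  case: (leqP (v + b).+1 r) => h.
    rewrite (_ : _ - _ = (r - 1 - v - b)%N%:Z); last by lia.
    by rewrite gw_two_point two_point_deg0; case: eqP => //; lia.
  rewrite /gw ltxx /= andbT ifF; last by apply/negbTE; rewrite -ltNge; lia.
  case: eqP => [vb|_]; last by rewrite mulr0 mul0r.
  rewrite (_ : (r%:Z - 1 - v%:Z - b%:Z) = -1); last by lia.
  by rewrite /= !mulr1.
rewrite /two_point_dot -gw_two_point; congr (gw _ _ [:: (_, _); _]); nia.
Qed.

Lemma gw2_dot0_neg f (v b : 'I_r.+1) : f < 0 -> gw2_dot M 0 v b f = 0.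
Proof. by rewrite /gw2_dot /= /gw => ->. Qed.

Lemma gw1_dot_neg f (v : 'I_r.+1) : f < 0 -> gw1_dot M v f = 0.
Proof. by rewrite /gw1_dot /gw => ->. Qed.

(** In positive degree this is the string equation; in degree 0 the conventions for tau_(-2)(pt) and
    for the pair tau_(-1)(pt), T_0 agree. *)
Lemma gw1_dotE f (v : 'I_r.+1) : gw1_dot M v f%:Z = two_point_dot f v 0.
Proof.
have := ltn_ord v; rewrite !ltnS => vr.
rewrite /gw1_dot; case: f => [|f].
  rewrite /two_point_dot mulr0 add0r addn0.
  case: (leqP v.+2 r) => h.
    rewrite (_ : _ - _ = (r - 2 - v)%N%:Z); last by lia.
    rewrite gw_one_point /one_point (integral_unstable hM); last by rewrite /stable card_unit.
    by case: eqP => //; lia.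
  rewrite /gw ltxx /= andbT ifF; last by apply/negbTE; rewrite -ltNge; lia.
  congr (_%:R); rewrite andbC; case: eqP => //= vE.
  by rewrite vE; apply/eqP; lia.
rewrite /two_point_dot (_ : (_ - 1 - v - 0)%N = (r.+1 * f.+1 + r - 2 - v).+1); last by nia.
rewrite string_equation // -gw_one_point; congr (gw _ _ [:: (_, _)]); nia.
Qed.

(** * The recursion for the corrected two-point numbers *)

Lemma gw_two_point_dimension f l (a c : 'I_r.+1) :
  l + a%:Z + c%:Z <> r.+1%:Z * f + r%:Z - 1 -> gw M f [:: (l, a); (0, c)] = 0.
Proof.
move=> h; case: (ltP f 0) => [f0|f0]; first by rewrite /gw f0.
case: f f0 h => // f _ h; case: (ltP l 0) => [l0|l0]; last first.
  case: l l0 h => // l _ h; rewrite gw_two_point two_point_dimension //.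
  by apply/eqP; lia.
rewrite /gw ltz_nat ltn0 /= [0 <= l]leNgt l0 /=; case: ifP => // /negbFE/eqP f0.
by case: eqP => [h1|_]; rewrite ?mulr0 ?mul0r //; case: eqP => [h2|_]; rewrite ?mulr0 //; lia.
Qed.

(** The dimension condition leaves one term of the sum over degrees and classes, and it is found by
    division with remainder: phi and c are the quotient and the remainder of i + 1 + b by r + 1. The
    conventions for negative indices make the same formula hold there. *)
Lemma gw2_dot_succ i (a b c : 'I_r.+1) (f : int) (phi : nat) :
  (r.+1 * phi + c = i.+1 + b)%N ->
  gw2_dot M i.+1 a b f = gw2_dot M i a b f
    - gw2_dot M i (dual c) b phi * gw2_dot M 0 a c (f - phi%:Z).
Proof.
move=> phiE; have ca := ltn_ord a; have cb := ltn_ord b; have cc := ltn_ord c.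
have uniq_divn (x y : int) (u v : nat) : (u < r.+1)%N -> (v < r.+1)%N ->
   r.+1%:Z * x + u%:Z = r.+1%:Z * y + v%:Z -> x = y /\ u = v.
  by move=> hu hv h; have : x = y; [nia | move=> xy; split=> //; subst; lia].
have gw2_dotE j l (x y : 'I_r.+1) t : l = r.+1%:Z * t + r%:Z - 1 - j%:Z - x%:Z - y%:Z ->
   gw2_dot M j x y t = gw2 M j l x y t by move=> ->.
set l := r.+1%:Z * f + r%:Z - 1 - i.+1%:Z - a%:Z - b%:Z.
rewrite [LHS](gw2_dotE _ l) //= (gw2_dotE i (l + 1)); last by rewrite /l; lia.
rewrite (gw2_dotE i 0 (dual c)); last by rewrite /dual /=; lia.
rewrite (gw2_dotE 0%N l); last by rewrite /l; lia.
case: (leP 0 l) => l0.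
  congr (_ - _).
  rewrite -(@fsbig_widen _ _ _ _ [set f - phi%:Z]%classic [set: int]%classic) //; last first.
    move=> f1 [_ /= h]; apply: big1 => c' _.
    rewrite gw_two_point_dimension ?mul0r // => hl.
    apply: h; have := ltn_ord c' => cc'.
    have [] := @uniq_divn (f1 - f + phi%:Z) 0 c c' cc cc'; last by lia.
    by move: hl; rewrite /l; lia.
  rewrite fsbig_set1 (bigD1 c) //= big1 ?addr0; last first.
    move=> c' cc'; rewrite gw_two_point_dimension ?mul0r // => hl.
    case/eqP: cc'; apply: val_inj => /=.
    have [] := @uniq_divn 0 0 c c' cc (ltn_ord c') _; last by lia.
    by move: hl; rewrite /l; lia.
  by rewrite mulrC; congr (gw2 _ _ _ _ _ _ * _); lia.
(* The convention for i >= 1 also describes ordinary invariants, because the second index is 0 and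
   so the sign is (-1)^0. *)
have gw2_neg j t (x y : 'I_r.+1) k : t < 0 ->
  gw2 M j t x y k = ((t == - j%:Z - 1) && (k == 0) && (x + y == r)%N)%:R.
  case: j => [|j] t0 /=; last by rewrite [0 <= t]leNgt t0.
  rewrite /gw; case: ltP => [k0|k0]; first by rewrite (lt_eqF k0) andbF.
  rewrite /= [0 <= t]leNgt t0 /=; case: eqP => [k00|]; last by rewrite andbF.
  rewrite andbT (max_idPr (ltW t0)) expr0z mul1r addr0.
  by case: (t == -1); case: (x + y == r)%N.
have lE : l = r.+1%:Z * f + r%:Z - 1 - i.+1%:Z - a%:Z - b%:Z by [].
clearbody l; rewrite [X in _ - _ * X](gw2_neg 0%N l) //.
case: (ltP (l + 1) 0) => l1.
  rewrite (gw2_neg i (l + 1)) //.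
  have -> : (l == - 0%:Z - 1) = false by apply/negbTE/eqP; lia.
  have -> : (l + 1 == - i%:Z - 1) = (l == - i.+1%:Z - 1) by apply/eqP/eqP; lia.
  by rewrite mulr0 subr0.
(* In this borderline case the corrected number is 0, while the index l + 1 = 0 is not covered by a
   convention: the two terms on the right must cancel. *)
have lE' : l = -1 by lia.
have -> : (l == - i.+1%:Z - 1) = false by apply/negbTE/eqP; lia.
have -> : (l == - 0%:Z - 1) by apply/eqP; lia.
have [fE cE] : f = phi%:Z /\ (r - a)%N = c.
  by apply: uniq_divn => //; [rewrite ltnS leq_subr | lia].
have -> : a = dual c by apply: val_inj => /=; lia.
rewrite fE lE' addNr subrr eqxx /= (_ : (_ == r)%N) ?mulr1 ?subrr //.
by apply/eqP; rewrite /dual /=; lia.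
Qed.

End GromovWitten.

(** * Residues *)

Section ResidueAtInfinity.
Variable F : fieldType.
Implicit Types p q : {poly F}.

(* The coefficient of 1/X in the expansion of p/q at infinity, for [q] monic. *)
Definition residue_oo p q : F := (p %% q)`_(size q).-2.

Lemma residue_ooD p1 p2 q :
  residue_oo (p1 + p2) q = residue_oo p1 q + residue_oo p2 q.
Proof. by rewrite /residue_oo modpD coefD. Qed.

Lemma residue_ooZ c p q : residue_oo (c *: p) q = c * residue_oo p q.
Proof. by rewrite /residue_oo modpZl coefZ. Qed.

Lemma residue_oo_sum I s (P : pred I) (f : I -> {poly F}) q :
  residue_oo (\sum_(i <- s | P i) f i) q = \sum_(i <- s | P i) residue_oo (f i) q.
Proof.
apply: (big_morph (residue_oo^~ q)) => [p1 p2|]; first exact: residue_ooD.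
by rewrite /residue_oo mod0p coef0.
Qed.

Lemma residue_ooE p q d t : p = d * q + t -> (size t < size q)%N ->
  residue_oo p q = t`_(size q).-2.
Proof. by move=> pE tq; rewrite /residue_oo -(modpP pE tq). Qed.

Lemma residue_oo_small p q : (size p < size q)%N -> residue_oo p q = p`_(size q).-2.
Proof. by apply: (@residue_ooE _ _ 0); rewrite mul0r add0r. Qed.

Lemma coefM_monic p q m : q \is monic -> (size p <= m.+1)%N ->
  (p * q)`_(m + (size q).-1) = p`_m.
Proof.
move=> qm pm; rewrite coefM.
have mlt : (m < (m + (size q).-1).+1)%N by rewrite ltnS leq_addr.
rewrite (bigD1 (Ordinal mlt)) //= addKn -lead_coefE (monicP qm) mulr1 big1 ?addr0 // => i im.
have [mi|mi] := ltnP m i; first by rewrite nth_default ?mul0r // (leq_trans pm).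
rewrite [q`__]nth_default ?mulr0 //.
have : (i < m)%N by rewrite ltn_neqAle mi andbT; apply: contra_neq im => h; apply: val_inj.
have : (0 < size q)%N by rewrite size_poly_gt0 monic_neq0.
by move=> h1 h2; rewrite -{1}(prednK h1) ltn_subRL ltn_add2r.
Qed.

(** Division of p by q with remainder t, multiplied by s, is a division of p s by q s with remainder
    t s, whose relevant coefficient is that of t. *)
Lemma residue_ooM2r p q s : q \is monic -> (1 < size q)%N -> s \is monic ->
  residue_oo (p * s) (q * s) = residue_oo p q.
Proof.
move=> qm q1 sm; have s0 : (0 < size s)%N by rewrite size_poly_gt0 monic_neq0.
have [d [t [-> tq]]] : exists d t, p = d * q + t /\ (size t < size q)%N.
  by exists (p %/ q), (p %% q); rewrite -divp_eq ltn_modp monic_neq0.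
have sz : size (q * s) = (size q + (size s).-1)%N.
  by rewrite size_monicM ?monic_neq0 //; lia.
rewrite [RHS](residue_ooE (erefl _)) // (@residue_ooE _ _ d (t * s)).
- rewrite -[RHS](coefM_monic sm); last by lia.
  by rewrite sz; congr _`__; lia.
- by ring.
- by rewrite sz (leq_ltn_trans (size_polyMleq _ _)) //; lia.
Qed.

Lemma dvdp_prod_coprime (I : eqType) (s : seq I) (f : I -> {poly F}) p :
  uniq s -> {in s &, forall i j, i != j -> coprimep (f i) (f j)} ->
  {in s, forall i, f i %| p} -> \prod_(i <- s) f i %| p.
Proof.
elim: s => [|x s IH]; first by rewrite big_nil dvd1p.
move=> /= /andP[xs us] cop dv; rewrite big_cons Gauss_dvdp; last first.
  rewrite big_seq; apply: (big_ind (fun q => coprimep (f x) q)).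
  - by rewrite coprimep1.
  - by move=> q1 q2 h1 h2; rewrite coprimepMr h1.
  - move=> i is_; apply: cop; rewrite ?inE ?eqxx ?is_ ?orbT //.
    by apply: contraNneq xs => ->.
rewrite dv ?inE ?eqxx //=; apply: IH => // [i j hi hj|i hi].
  by apply: cop; rewrite inE ?hi ?hj orbT.
by apply: dv; rewrite inE hi orbT.
Qed.

Lemma coef_comp_XsubC_top p m c : (size p <= m.+1)%N -> (p \Po ('X - c%:P))`_m = p`_m.
Proof.
move=> pm; have [sp|sp] := ltnP (size p) m.+1.
  rewrite [RHS]nth_default // nth_default // size_comp_poly2 ?size_XsubC //.
have {pm sp} sp : size p = m.+1 by apply/eqP; rewrite eqn_leq pm.
have -> : m = (size (p \Po ('X - c%:P))).-1 by rewrite size_comp_poly2 ?size_XsubC // sp.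
rewrite -[LHS]/(lead_coef _) lead_coef_comp ?size_XsubC // lead_coefXsubC expr1n mulr1.
by rewrite size_comp_poly2 ?size_XsubC // /lead_coef sp.
Qed.

Lemma dvdXn_coef0 m p i : 'X^m %| p -> (i < m)%N -> p`_i = 0.
Proof. by move=> /dvdpP[q ->] im; rewrite coefMXn im. Qed.

Lemma dvdXnP m p : (forall i, (i < m)%N -> p`_i = 0) -> 'X^m %| p.
Proof.
move=> h; rewrite -[p](poly_take_drop m) dvdp_addl ?dvdp_mull ?dvdpp //.
suff -> : take_poly m p = 0 by rewrite dvdp0.
by apply/polyP => i; rewrite coef_take_poly coef0; case: ifP => // /h.
Qed.

(* The sum of the residues at the finite poles, the residue at [x u] being the
   coefficient of X^m in p(X + x u) * inv u, where [inv u] inverts the cofactor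
   of (X - x u)^(m+1) locally. *)
Lemma sum_residues (I : finType) (x : I -> F) (m : nat) (inv : I -> {poly F}) p :
  injective x ->
  (forall u, 'X^(m.+1) %| ((\prod_(l | l != u) ('X - (x l)%:P) ^+ m.+1) \Po ('X + (x u)%:P))
                         * inv u - 1) ->
  \sum_u ((p \Po ('X + (x u)%:P)) * inv u)`_m
    = residue_oo p (\prod_u ('X - (x u)%:P) ^+ m.+1).
Proof.
move=> xinj invP; set D := \prod_u _.
(* [h u] is the numerator of the principal part at [x u]. Recombined, these numerators give [T],
   congruent to p modulo every (X - x u)^(m+1) and of smaller degree than [D]: it is the remainder
   of p by [D]. *)
pose h u := take_poly m.+1 ((p \Po ('X + (x u)%:P)) * inv u).
pose C u := \prod_(l | l != u) ('X - (x l)%:P) ^+ m.+1.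
pose T := \sum_u (h u \Po ('X - (x u)%:P)) * C u.
have CD u : D = ('X - (x u)%:P) ^+ m.+1 * C u by rewrite /D (bigD1 u).
have Cm u : C u \is monic by apply: monic_prod => l _; rewrite monic_exp ?monicXsubC.
have Dm : D \is monic by apply: monic_prod => l _; rewrite monic_exp ?monicXsubC.
have szD u : size D = (m.+1 + size (C u))%N.
  by rewrite (CD u) size_monicM ?monic_exp ?monicXsubC ?monic_neq0 // size_exp_XsubC.
have szC u : (0 < size (C u))%N by rewrite size_poly_gt0 monic_neq0.
have szh u : (size (h u \Po ('X - (x u)%:P)%R) <= m.+1)%N.
  by rewrite size_comp_poly2 ?size_XsubC // size_take_poly.
have sD : (0 < size D)%N by rewrite size_poly_gt0 monic_neq0.
have szT : (size T < size D)%N.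
  rewrite -(prednK sD) ltnS; apply: leq_trans (size_sum _ _ _) _.
  apply/bigmax_leqP => u _; apply: leq_trans (size_polyMleq _ _) _.
  by move: (szh u) (szC u); rewrite (szD u); lia.
have dvT u : ('X - (x u)%:P) ^+ m.+1 %| p - T.
  have -> : ('X - (x u)%:P) ^+ m.+1 = 'X^(m.+1) \Po ('X - (x u)%:P).
    by rewrite rmorphXn /= comp_polyX.
  rewrite -[p - T](comp_polyXaddC_K _ (x u)) dvdp_comp_poly //.
  rewrite /T (bigD1 u) //= comp_polyB comp_polyD comp_polyM opprD addrA.
  rewrite dvdp_subl.
    rewrite -comp_polyA comp_polyB comp_polyX comp_polyC addrK comp_polyXr.
    have -> : (p \Po ('X + (x u)%:P)) - h u * (C u \Po ('X + (x u)%:P))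
      = ((p \Po ('X + (x u)%:P)) * inv u - h u) * (C u \Po ('X + (x u)%:P))
        - (p \Po ('X + (x u)%:P)) * ((C u \Po ('X + (x u)%:P)) * inv u - 1) by ring.
    apply: dvdp_sub; [apply: dvdp_mulr | exact/dvdp_mull/invP].
    by rewrite -{1}[_ * _](poly_take_drop m.+1) -/(h u) addrC addKr dvdp_mull ?dvdpp.
  rewrite raddf_sum; apply: (big_ind (fun q => 'X^(m.+1) %| q)).
  - exact: dvdp0.
  - by move=> ? ? ? ?; apply: dvdp_add.
  - move=> v vu; rewrite /= comp_polyM dvdp_mull // /C (bigD1 u) /=; last by rewrite eq_sym.
    rewrite comp_polyM.
    rewrite dvdp_mulr // rmorphXn /= comp_polyB comp_polyX comp_polyC addrK dvdpp //.
have DdvT : D %| p - T.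
  rewrite /D; apply: dvdp_prod_coprime => [|u v _ _ uv|u _]; last exact: dvT.
    exact: index_enum_uniq.
  apply/coprimep_expl/coprimep_expr/coprimep_XsubC2.
  by rewrite subr_eq0 (inj_eq xinj) eq_sym.
rewrite (@residue_ooE p D ((p - T) %/ D) T) ?divpK ?subrK //.
rewrite /T coef_sum; apply: eq_bigr => u _.
have -> : (size D).-2 = (m + (size (C u)).-1)%N by rewrite (szD u); move: (szC u); lia.
by rewrite coefM_monic // coef_comp_XsubC_top ?size_take_poly // coef_take_poly ltnSn.
Qed.
End ResidueAtInfinity.

(** * Polynomial dependence of the residue at infinity on the degree *)

Section ResiduesAsPolynomials.

(** A is allowed to vanish, so [polyfun f s 0] expresses degree less than s; leading terms can thus
    be tracked through sums. *)
Definition polyfun (f : nat -> rat) (s : nat) (A : rat) :=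
  exists q : {poly rat}, [/\ (size q <= s.+1)%N, q`_s = A & forall n, f n = q.[n%:R]].

Lemma polyfun_ext f g s A : f =1 g -> polyfun g s A -> polyfun f s A.
Proof. by move=> fg [q [h1 h2 h3]]; exists q; split=> // n; rewrite fg. Qed.

Lemma polyfun_const c : polyfun (fun=> c) 0 c.
Proof.
by exists c%:P; split=> [||n]; rewrite ?size_polyC_leq1 ?coefC ?hornerC.
Qed.

Lemma polyfun_add f g s A B :
  polyfun f s A -> polyfun g s B -> polyfun (fun n => f n + g n) s (A + B).
Proof.
move=> [p [p1 p2 p3]] [q [q1 q2 q3]]; exists (p + q); split=> [||n].
- by rewrite (leq_trans (size_polyD _ _)) // geq_max p1.
- by rewrite coefD p2 q2.
- by rewrite hornerD p3 q3.
Qed.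

Lemma polyfun_scale c f s A : polyfun f s A -> polyfun (fun n => c * f n) s (c * A).
Proof.
move=> [p [p1 p2 p3]]; exists (c *: p); split=> [||n].
- by rewrite (leq_trans (size_scale_leq _ _)).
- by rewrite coefZ p2.
- by rewrite hornerZ p3.
Qed.

Lemma polyfun_widen f s A : polyfun f s A -> polyfun f s.+1 0.
Proof.
move=> [p [p1 p2 p3]]; exists p; split=> //; first exact: leqW.
by rewrite nth_default.
Qed.

Lemma polyfun_mul_linear c f s A :
  polyfun f s A -> polyfun (fun n => (n%:R + c) * f n) s.+1 A.
Proof.
move=> [p [p1 p2 p3]]; exists (p * ('X + c%:P)); split=> [||n].
- by rewrite (leq_trans (size_polyMleq _ _)) // size_XaddC addn2 /= ltnS.
- by rewrite mulrDr coefD coefMX coefMC [p`_s.+1]nth_default // mul0r addr0.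
- by rewrite hornerM hornerD hornerX hornerC p3 mulrC.
Qed.

Lemma polyfun_sum I (S : seq I) (f : I -> nat -> rat) s (A : I -> rat) :
  (forall i, polyfun (f i) s (A i)) ->
  polyfun (fun n => \sum_(i <- S) f i n) s (\sum_(i <- S) A i).
Proof.
move=> h; elim: S => [|x S IH].
  exists 0; split=> [||n]; by rewrite ?size_poly0 ?big_nil ?coef0 ?horner0.
rewrite big_cons; apply: (@polyfun_ext _ (fun n => f x n + \sum_(i <- S) f i n)).
  by move=> n; rewrite big_cons.
exact: polyfun_add.
Qed.

Lemma coef_Xadd1_exp n i : (('X + 1%:P : {poly rat}) ^+ n)`_i = 'C(n, i)%:R.
Proof.
elim: n i => [|n IH] i; first by rewrite expr0 coef1 bin0n.
rewrite exprSr mulrDr mulr1 coefD coefMX !IH.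
by case: i => [|i]; rewrite ?add0r ?bin0 // binS natrD addrC.
Qed.

Lemma poly_antidifference s (p : {poly rat}) : (size p <= s)%N ->
  exists q : {poly rat}, [/\ (size q <= s.+1)%N, q`_s * s%:R = p`_s.-1
    & q \Po ('X + 1%:P) - q = p].
Proof.
elim: s p => [|s IH] p ps.
  move: ps; rewrite leqn0 size_poly_eq0 => /eqP ->.
  by exists 0; rewrite size_poly0 !coef0 mul0r comp_poly0 subr0.
pose c := p`_s / s.+1%:R.
pose E : {poly rat} := ('X + 1%:P) ^+ s.+1 - 'X^(s.+1).
have coefE j : E`_j = 'C(s.+1, j)%:R - (j == s.+1)%:R.
  by rewrite coefB coef_Xadd1_exp coefXn.
have s0 : s.+1%:R != 0 :> rat by rewrite pnatr_eq0.
have Es : (size (p - c *: E)%R <= s)%N.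
  apply/leq_sizeP => j; rewrite leq_eqVlt => /orP[/eqP <-|sj].
    rewrite coefB coefZ coefE binSn (_ : (s == s.+1) = false) ?subr0; last by lia.
    by rewrite divfK // subrr.
  rewrite coefB coefZ coefE nth_default ?(leq_trans ps) // sub0r.
  move: sj; rewrite leq_eqVlt => /orP[/eqP <-|sj].
    by rewrite binn eqxx subrr mulr0 oppr0.
  by rewrite bin_small // gtn_eqF // subrr mulr0 oppr0.
have [q [q1 _ q3]] := IH _ Es; exists (q + c *: 'X^(s.+1)); split.
- rewrite (leq_trans (size_polyD _ _)) // geq_max leqW // (leq_trans (size_scale_leq _ _)) //.
  by rewrite size_polyXn.
- by rewrite coefD coefZ coefXn eqxx nth_default // add0r mulr1 divfK.
- rewrite comp_polyD comp_polyZ rmorphXn /= comp_polyX.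
  have -> : p = (p - c *: E) + c *: E by rewrite subrK.
  by rewrite -q3 /E scalerBr; ring.
Qed.

Lemma polyfun_antidifference (f g : nat -> rat) s A :
  (forall n, f n.+1 = f n + g n) -> polyfun g s A ->
  polyfun f s.+1 (A / s.+1%:R).
Proof.
move=> fg [p [p1 p2 p3]]; have [q [q1 q2 q3]] := poly_antidifference p1.
exists (q + (f 0%N - q.[0])%:P); split=> [||n].
- rewrite (leq_trans (size_polyD _ _)) // geq_max q1 (leq_trans (size_polyC_leq1 _)) //.
- by rewrite coefD coefC addr0 -p2 -q2 mulfK // pnatr_eq0.
- rewrite hornerD hornerC; elim: n => [|n IH]; first by rewrite addrC subrK.
  rewrite fg IH p3 -q3 hornerD hornerN horner_comp hornerD hornerX hornerC -natr1; ring.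
Qed.

Variables (r b0 : nat) (b0r : (b0 <= r)%N) (eps : nat -> nat).

Let beta : rat := (3%:R - r%:R) / 2%:R.
(** The r + 1 new factors of the bracket when D grows by 1, centred at the new pole D + 1. *)
Let step : {poly rat} := \prod_(i < r.+1) ('X + ((beta + i%:R) / r.+1%:R)%:P).

Definition pole_poly D : {poly rat} := \prod_(l < D.+1) ('X - (l%:R)%:P) ^+ r.+1.

(** The bracket product in the variable z = (r+1)(Y - u), divided by a power of r + 1 to make it
    monic; D stands for d - e_0, and the u-dependence cancels. *)
Definition bracket_poly D : {poly rat} :=
  \prod_(i < r.+1 * D + b0) ('X - (D%:R)%:P + ((beta + i%:R) / r.+1%:R)%:P).

Definition column_poly s : {poly rat} :=
  'X^(r - b0) * \prod_(i < s) ('X - ((eps i)%:R)%:P).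

(** The t extra poles at D + 1 interpolate between the denominators for D and for D + 1, which makes
    a recursion in D possible. *)
Let column_residue t D s :=
  residue_oo (bracket_poly D * column_poly s) (pole_poly D * ('X - (D.+1%:R)%:P) ^+ t).

Lemma step_monic : step \is monic.
Proof. by apply: monic_prod => i _; rewrite monicE lead_coefXaddC. Qed.

Lemma size_step : size step = r.+2.
Proof.
rewrite /step (eq_bigr (fun i : 'I_r.+1 => 'X - (- ((beta + i%:R) / r.+1%:R))%:P)).
  by rewrite size_prod_XsubC /index_enum -enumT size_enum_ord.
by move=> i _; rewrite polyCN opprK.
Qed.

(** The sum of ([beta] + i)/(r+1) over i = 0, ..., r is [beta] + r/2, and [beta] = (3-r)/2. *)
Lemma coef_step : step`_r = 3%:R / 2%:R.
Proof.
pose ps : seq rat := [seq - ((beta + i%:R) / r.+1%:R) | i <- iota 0 r.+1].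
have szps : size ps = r.+1 by rewrite size_map size_iota.
have -> : step = \prod_(x <- ps) ('X - x%:P).
  rewrite /ps big_map -[iota _ _]/(index_iota 0 r.+1) big_mkord /step.
  by apply: eq_bigr => i _; rewrite polyCN opprK.
have -> : r = (size ps).-1 by rewrite szps.
rewrite coefPn_prod_XsubC ?szps // /ps big_map -[iota _ _]/(index_iota 0 r.+1).
rewrite sumrN opprK -mulr_suml big_split /= sumr_const_nat subn0 -mulr_natr.
have -> : forall k, \sum_(0 <= i < k.+1) i%:R = (k.+1 * k)%:R / 2%:R :> rat.
  elim=> [|k IH]; first by rewrite big_nat1 muln0 mul0r.
  by rewrite big_nat_recr //= IH !natrM -!natr1; field.
rewrite natrM /beta -[r.+1%:R]natr1; field.
by rewrite natr1 pnatr_eq0.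
Qed.

Lemma monic_pole_poly D : pole_poly D \is monic.
Proof. by apply: monic_prod => l _; rewrite monic_exp ?monicXsubC. Qed.

Lemma size_pole_poly D : size (pole_poly D) = (r.+1 * D.+1).+1.
Proof.
elim: D => [|D IH]; rewrite /pole_poly big_ord_recr /=.
  by rewrite big_ord0 mul1r size_exp_XsubC muln1.
rewrite size_monicM ?monic_neq0 ?monic_exp ?monicXsubC ?monic_pole_poly //.
by rewrite -/(pole_poly D) IH size_exp_XsubC; lia.
Qed.

Lemma monic_bracket_poly D : bracket_poly D \is monic.
Proof.
apply: monic_prod => i _; rewrite -addrA -polyCN -polyCD monicE.
by rewrite lead_coefXaddC.
Qed.

Lemma size_bracket_poly D : size (bracket_poly D) = (r.+1 * D + b0).+1.
Proof.
rewrite /bracket_poly.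
rewrite (eq_bigr (fun i : 'I__ => 'X - (D%:R - ((beta + i%:R) / r.+1%:R))%:P)).
  by rewrite size_prod_XsubC /index_enum -enumT size_enum_ord.
by move=> i _; rewrite polyCB opprB addrAC addrA.
Qed.

(** The numerator is monic of degree (r+1)D + r, exactly one below the degree of [pole_poly D];
    extra poles increase the gap. *)
Lemma column_residue0 t D : column_residue t D 0 = (t == 0)%:R.
Proof.
have szN : size (bracket_poly D * column_poly 0) = (r.+1 * D.+1)%N.
  rewrite /column_poly big_ord0 mulr1 size_Mmonic ?monic_neq0 ?monic_bracket_poly ?monicXn //.
  by rewrite size_bracket_poly size_polyXn; lia.
have szD : size (pole_poly D * ('X - (D.+1%:R)%:P) ^+ t) = (r.+1 * D.+1 + t).+1.
  rewrite size_monicM ?monic_pole_poly ?monic_neq0 ?monic_exp ?monicXsubC //.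
  by rewrite size_pole_poly size_exp_XsubC; lia.
rewrite /column_residue residue_oo_small; last by rewrite szN szD; lia.
rewrite szD; case: t {szD} => [|t]; last by rewrite nth_default // szN; lia.
rewrite addn0 -[X in _`_X.-1]szN -lead_coefE; apply/eqP; rewrite -monicE.
by rewrite monicMl ?monic_bracket_poly // /column_poly big_ord0 mulr1 monicXn.
Qed.

(** The new factor is (X - (D+1)) + (D + 1 - eps_s), and its first summand cancels one extra
    pole. *)
Lemma column_residue_succ t D s :
  column_residue t.+1 D s.+1
    = column_residue t D s + (D%:R + (1 - (eps s)%:R)) * column_residue t.+1 D s.
Proof.
set q := 'X - (D.+1%:R)%:P : {poly rat}.
have -> : column_residue t D s
  = residue_oo (bracket_poly D * column_poly s * q) (pole_poly D * q ^+ t.+1).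
  rewrite exprSr [pole_poly D * _]mulrA residue_ooM2r ?monicXsubC //.
    by rewrite monicMl ?monic_pole_poly // monic_exp ?monicXsubC.
  rewrite size_monicM ?monic_pole_poly ?monic_neq0 ?monic_exp ?monicXsubC //.
  by rewrite size_pole_poly size_exp_XsubC; lia.
rewrite -residue_ooZ -residue_ooD; congr residue_oo.
rewrite /column_poly big_ord_recr /= -mul_polyC /q -natr1 !rmorphD /= rmorphN /=; ring.
Qed.

Lemma bracket_poly_succ D :
  bracket_poly D.+1 = bracket_poly D * (step \Po ('X - (D.+1%:R)%:P)).
Proof.
rewrite /bracket_poly mulnS -addnA big_split_ord /= mulrC; congr (_ * _).
  apply: eq_bigr => i _; rewrite natrD addrCA mulrDl divff ?pnatr_eq0 //.
  by rewrite -natr1 !polyCD; ring.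
rewrite /step rmorph_prod; apply: eq_bigr => i _ /=.
by rewrite comp_polyD comp_polyX comp_polyC.
Qed.

(** Expand [step] in powers of X - (D+1); each power cancels part of the new pole of order r + 1. *)
Lemma column_residue_pole_succ D s :
  column_residue 0 D.+1 s
    = \sum_(t < r.+2) step`_(r.+1 - t) * column_residue t D s.
Proof.
set q := 'X - (D.+1%:R)%:P : {poly rat}.
rewrite /column_residue expr0 mulr1 bracket_poly_succ comp_polyE size_step mulrAC mulr_sumr.
rewrite residue_oo_sum (reindex_inj rev_ord_inj) /=; apply: eq_bigr => t _.
have tr : (t <= r.+1)%N by have := ltn_ord t.
rewrite subSS -scalerAr residue_ooZ; congr (_ * _).
rewrite -(@residue_ooM2r _ _ (pole_poly D * q ^+ t) (q ^+ (r.+1 - t))).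
- congr residue_oo; rewrite -mulrA -exprD subnKC // /pole_poly big_ord_recr //.
- by rewrite monicMl ?monic_pole_poly // monic_exp ?monicXsubC.
- rewrite size_monicM ?monic_pole_poly ?monic_neq0 ?monic_exp ?monicXsubC //.
  by rewrite size_pole_poly size_exp_XsubC; lia.
- by rewrite monic_exp ?monicXsubC.
Qed.

(** The three assertions are proved together. An extra pole costs one degree and two cost more, so
    in the difference equation in D only the term with t = 1, weighted by 3/2, affects the leading
    coefficient. All leading coefficients arise from positive numbers by sums, products and
    quotients. *)
Lemma column_residue_polyfun s :
  [/\ exists2 A, 0 < A & polyfun (fun D => column_residue 0 D s) s A,
      exists2 B, 0 < B & polyfun (fun D => column_residue 1 D s.+1) s B
    & forall t, polyfun (fun D => column_residue t.+2 D s.+1) s 0].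
Proof.
elim: s => [|s [[A A0 hA] [B B0 hB] hC]].
  split.
  - exists 1; rewrite ?ltr01 //; apply: polyfun_ext (polyfun_const 1) => D.
    by rewrite column_residue0.
  - exists 1; rewrite ?ltr01 //; apply: polyfun_ext (polyfun_const 1) => D.
    by rewrite column_residue_succ !column_residue0 mulr0 addr0.
  - by move=> t; apply: polyfun_ext (polyfun_const 0) => D;
      rewrite column_residue_succ !column_residue0 mulr0 addr0.
have hA' : polyfun (fun D => column_residue 0 D s.+1) s.+1 ((3%:R / 2%:R * B) / s.+1%:R).
  (* As [step] is monic, the term t = 0 is the value at D itself; what remains is the difference of
     consecutive values. *)
  apply: (@polyfun_antidifference _ (fun D => step`_r * column_residue 1 D s.+1
             + \sum_(t < r) step`_(r.-1 - t) * column_residue t.+2 D s.+1)).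
    move=> D; rewrite column_residue_pole_succ !big_ord_recl /= subn0 subSS subn0.
    have -> : step`_r.+1 = 1 by rewrite -(monicP step_monic) lead_coefE size_step.
    rewrite mul1r; congr (_ + (_ + _)).
    by apply: eq_bigr => t _; rewrite /bump /=; congr (step`__ * column_residue _ _ _); lia.
  rewrite -[_ * B]addr0 -[in X in _ + X](@big1 _ 0 +%R _ (index_enum 'I_r) xpredT (fun=> 0)) //.
  apply: polyfun_add; first by rewrite -coef_step; apply: polyfun_scale.
  apply: polyfun_sum => t.
  by have := polyfun_scale step`_(r.-1 - t) (hC t); rewrite mulr0.
split.
- eexists; last exact: hA'.
  by rewrite divr_gt0 ?ltr0n // mulr_gt0 // divr_gt0.
- exists ((3%:R / 2%:R * B) / s.+1%:R + B); last first.
    apply: polyfun_ext (polyfun_add hA' (polyfun_mul_linear (1 - (eps s.+1)%:R) hB)).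
    by move=> D; rewrite column_residue_succ.
  by rewrite addr_gt0 // divr_gt0 ?ltr0n // mulr_gt0 // divr_gt0.
- move=> t.
  have h1 : polyfun (fun D => column_residue t.+1 D s.+1) s.+1 0.
    by case: t => [|t]; [apply: polyfun_widen hB | apply: polyfun_widen (hC t)].
  rewrite -[0]addr0.
  apply: polyfun_ext (polyfun_add h1 (polyfun_mul_linear (1 - (eps s.+1)%:R) (hC t))).
  by move=> D; rewrite column_residue_succ.
Qed.

Lemma residue_oo_column_poly s : exists w : {poly rat}, size w = s.+1 /\
  forall D, residue_oo (bracket_poly D * column_poly s) (pole_poly D) = w.[D%:R].
Proof.
have [[A A0 [w [w1 w2 w3]]] _ _] := column_residue_polyfun s.
exists w; split=> [|D]; last by rewrite -w3 /column_residue expr0 mulr1.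
apply/eqP; rewrite eqn_leq w1 ltnNge; apply/negP => ws.
by move: A0; rewrite -w2 nth_default // ltxx.
Qed.

End ResiduesAsPolynomials.

(** The matrix of values is a Vandermonde matrix times the triangular matrix of coefficients, whose
    diagonal holds the leading coefficients. *)
Lemma det_poly_neq0 N (w : nat -> {poly rat}) (x : 'I_N -> rat) :
  (forall j, size (w j) = j.+1) -> injective x ->
  \det (\matrix_(i < N, j < N) (w j).[x i]) != 0.
Proof.
move=> sw xinj.
have -> : \matrix_(i < N, j < N) (w j).[x i]
   = (Vandermonde N (\row_i x i))^T *m \matrix_(s < N, j < N) (w j)`_s.
  apply/matrixP => i j; rewrite !mxE (horner_coef_wide _ (_ : _ <= N)%N) ?sw //.
  by apply: eq_bigr => s _; rewrite !mxE mulrC.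
rewrite det_mulmx det_tr det_Vandermonde mulf_neq0 //.
  apply/prodf_neq0 => i _; apply/prodf_neq0 => j ij.
  by rewrite !mxE subr_eq0 (inj_eq xinj); apply: contraTneq ij => ->; rewrite ltnn.
rewrite -det_tr det_trig.
  apply/prodf_neq0 => i _; rewrite !mxE.
  have -> : (w i)`_i = lead_coef (w i) by rewrite lead_coefE sw.
  by rewrite lead_coef_eq0 -size_poly_eq0 sw.
apply/is_trig_mxP => i j ij; rewrite !mxE nth_default // sw //.
Qed.

Lemma prod_ord_around (R : comPzRingType) (F : nat -> R) D u : (u <= D)%N ->
  \prod_(l < D.+1) F l = F u * (\prod_(i < u) F i * \prod_(i < D - u) F (i + u.+1)%N).
Proof.
move=> ud; rewrite -(big_mkord xpredT F) (@big_cat_nat _ _ _ u) //=; last by lia.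
have := big_addn 0 D.+1 u.+1 xpredT F (idx := 1) (op := *%R); rewrite add0n => shift.
by rewrite (@big_ltn _ _ _ u) // mulrCA shift !big_mkord subSS.
Qed.

(** * The matrix V *)

Lemma coef_comp_polyNX (R : nzRingType) (p : {poly R}) i :
  (p \Po - 'X)`_i = p`_i * (-1) ^+ i.
Proof.
rewrite coef_comp_poly.
have hX j : ((- 'X : {poly R}) ^+ j)`_i = (-1) ^+ j * (i == j)%:R.
  elim: j (i) => [|j IH] k; first by rewrite !expr0 coef1 mul1r.
  rewrite exprS [- 'X * _]mulNr coefN coefXM exprS; case: k => [|k]; first by rewrite oppr0 mulr0.
  by rewrite IH eqSS mulN1r mulNr.
have [ip|ip] := ltnP i (size p); last first.
  rewrite [in RHS]nth_default // mul0r big1 // => j _.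
  by rewrite hX gtn_eqF ?mulr0 // (leq_trans (ltn_ord j)).
rewrite (bigD1 (Ordinal ip)) //= hX eqxx mulr1 big1 ?addr0 // => j ji.
rewrite hX (_ : (i == j) = false) ?mulr0 //.
by apply: contraNF ji => /eqP h; apply/eqP/val_inj.
Qed.

Lemma fsbig_int_window (F : int -> rat) (x0 : int) (D : nat) :
  (forall x, x < x0 \/ x0 + D%:Z < x -> F x = 0) ->
  \sum_(x \in [set: int]) F x = \sum_(u < D.+1) F (x0 + u%:Z).
Proof.
move=> hF; pose s := [seq x0 + u%:Z | u <- iota 0 D.+1].
rewrite -(fsbig_widen [set` s]) //=; last first.
  move=> x [_ /= xs]; apply: hF.
  case: (ltP x x0) => h1; [by left | right]; rewrite ltNge; apply/negP => h2.
  apply: xs; apply/mapP; exists `|x - x0|%N; last by lia.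
  by rewrite mem_iota; lia.
rewrite -fsbig_seq; last by rewrite map_inj_uniq ?iota_uniq // => u v; lia.
by rewrite big_map -[iota _ _]/(index_iota 0 D.+1) big_mkord.
Qed.

(** * Generating functions of the two-point invariants *)

Section Assembly.
Variables (r : nat) (M : moduli_data).
Hypothesis hr : (1 <= r)%N.
Hypothesis hM : stable_maps_axioms r M.

Definition two_point_poly f b : {poly rat} :=
  \poly_(w < r.+1) two_point_dot r M f (r - w) b.

(** Multiplication by X replaces T_v by T_(v+1), so this is [two_point_dot_rec] read
    coefficientwise. For b = r the class T_(b+1) vanishes and the term of degree f - 1 takes its
    place. *)
Lemma two_point_poly_rec f b : (b <= r)%N ->
  'X^(r.+1) %| ('X + (f%:R)%:P) * two_point_poly f b
     - (if (b < r)%N then two_point_poly f b.+1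
        else if f is f'.+1 then two_point_poly f' 0 else 0).
Proof.
move=> br; apply: dvdXnP => w wr.
have vr : (r - w <= r)%N by rewrite leq_subr.
have := two_point_dot_rec hr hM f vr br.
rewrite coefB mulrDl coefD coefXM coefCM /two_point_poly !coef_poly wr => h.
(* At w = 0 the shifted index is r + 1, where the invariant vanishes. *)
have -> : (if w == 0%N then 0
   else if (w.-1 < r.+1)%N then two_point_dot r M f (r - w.-1) b else 0)
   = two_point_dot r M f (r - w).+1 b.
  case: w wr {h vr} => [|w] wr /=.
    rewrite subn0 /two_point_dot; case: (f) => [|f'].
      by case: eqP => //; lia.
    by rewrite (two_point_evH_nilpotent hM) // ltnSn.
  by rewrite (ltn_trans _ wr) ?subnSK.
rewrite [_ + f%:R * _]addrC h.
move: br; rewrite leq_eqVlt => /orP[/eqP bE|br].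
  rewrite bE ltnn eqxx mul1r.
  have -> : two_point_dot r M f (r - w) r.+1 = 0.
    rewrite /two_point_dot; case: (f) => [|f']; first by case: eqP => //; lia.
    by rewrite (two_point_evH_nilpotent hM) // ltnSn orbT.
  case: f {h} => [|f]; first by rewrite coef0 subrr.
  by rewrite coef_poly wr add0r subrr.
by rewrite (ltn_eqF br) br mul0r addr0 coef_poly wr subrr.
Qed.

Lemma two_point_poly0 b : (b <= r)%N -> two_point_poly 0 b = 'X^b.
Proof.
move=> br; apply/polyP => w; rewrite coef_poly coefXn /=.
case: ltnP => wr; last by case: eqP => //; lia.
by congr (_%:R); apply/eqP/eqP; lia.
Qed.

Lemma two_point_poly_exp f b : (b <= r)%N ->
  'X^(r.+1) %| two_point_poly f b - ('X + (f%:R)%:P) ^+ b * two_point_poly f 0.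
Proof.
elim: b => [|b IH] br; first by rewrite expr0 mul1r subrr dvdp0.
have := two_point_poly_rec f (ltnW br); rewrite br => h.
have -> : two_point_poly f b.+1 - ('X + (f%:R)%:P) ^+ b.+1 * two_point_poly f 0
 = ('X + (f%:R)%:P) * (two_point_poly f b - ('X + (f%:R)%:P) ^+ b * two_point_poly f 0)
  - (('X + (f%:R)%:P) * two_point_poly f b - two_point_poly f b.+1).
  by rewrite exprS; ring.
by rewrite dvdp_sub // dvdp_mull // IH // ltnW.
Qed.

(* By the string equation, this is the J-function of P^r. *)
Lemma two_point_poly_inv f :
  'X^(r.+1) %| (\prod_(i < f) ('X + (i.+1%:R)%:P) ^+ r.+1) * two_point_poly f 0 - 1.
Proof.
elim: f => [|f IH]; first by rewrite big_ord0 mul1r two_point_poly0 // subrr dvdp0.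
have := two_point_poly_rec f.+1 (leqnn r); rewrite ltnn => h1.
have h2 := two_point_poly_exp f.+1 (leqnn r).
rewrite big_ord_recr /=; set P := \prod_(i < f) _; set Y := 'X + _.
have -> : P * Y ^+ r.+1 * two_point_poly f.+1 0 - 1
  = P * (Y * two_point_poly f.+1 r - two_point_poly f 0)
   - P * Y * (two_point_poly f.+1 r - Y ^+ r * two_point_poly f.+1 0)
   + (P * two_point_poly f 0 - 1) by rewrite exprS; ring.
by apply: dvdp_add => //; apply: dvdp_sub; apply: dvdp_mull.
Qed.

(** Seen from the pole u, the poles below it contribute the product of the (X+i)^(r+1) for i = 1,
    ..., u, and those above it the analogous product up to D - u with X replaced by -X, up to sign.
    Each is inverted by a two-point generating function. *)
Definition local_inverse D u : {poly rat} :=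
  two_point_poly u 0 * ((-1) ^+ (r.+1 * (D - u)) *: (two_point_poly (D - u) 0 \Po - 'X)).

Lemma local_inverseP D (u : 'I_D.+1) :
  'X^(r.+1) %| ((\prod_(l < D.+1 | l != u) ('X - (l%:R)%:P) ^+ r.+1) \Po ('X + (u%:R)%:P))
                * local_inverse D u - 1.
Proof.
pose Q f : {poly rat} := \prod_(i < f) ('X + (i.+1%:R)%:P) ^+ r.+1.
have ud : (u <= D)%N by rewrite -ltnS.
have -> : (\prod_(l < D.+1 | l != u) ('X - (l%:R)%:P) ^+ r.+1) \Po ('X + (u%:R)%:P)
   = Q u * ((-1) ^+ (r.+1 * (D - u)) *: (Q (D - u)%N \Po - 'X)).
  have QN n : \prod_(i < n) ('X - (i.+1%:R)%:P) ^+ r.+1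
     = (-1) ^+ (r.+1 * n) *: (Q n \Po - 'X).
    elim: n => [|n IH]; first by rewrite /Q !big_ord0 muln0 expr0 comp_polyC scale1r.
    rewrite /Q !big_ord_recr /= -/(Q n) IH comp_polyM mulnS addnC exprD.
    have -> : ('X - (n.+1%:R)%:P) ^+ r.+1
      = (-1) ^+ r.+1 *: (('X + (n.+1%:R)%:P) ^+ r.+1 \Po - 'X) :> {poly rat}.
      by rewrite rmorphXn /= comp_polyD comp_polyX comp_polyC -exprZn scaleN1r opprD opprK.
    by rewrite -!mul_polyC polyCM; ring.
  (* Restoring the omitted factor of the pole u allows the full product to be split around u. *)
  apply: (@mulfI _ ('X ^+ r.+1)); first by rewrite expf_neq0 // polyX_eq0.
  have -> : 'X ^+ r.+1 = ('X - (u%:R)%:P) ^+ r.+1 \Po ('X + (u%:R)%:P) :> {poly rat}.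
    by rewrite rmorphXn /= comp_polyB comp_polyX comp_polyC addrK.
  rewrite -comp_polyM -(bigD1 u (P := xpredT)) //=.
  rewrite (prod_ord_around (fun l => ('X - (l%:R)%:P) ^+ r.+1) ud) !comp_polyM.
  congr (_ * (_ * _)).
  - rewrite rmorph_prod /= /Q [RHS](reindex_inj rev_ord_inj); apply: eq_bigr => i _.
    rewrite rmorphXn /= comp_polyB comp_polyX comp_polyC subnSK // natrB ?(ltnW (ltn_ord i)) //.
    by rewrite polyCB addrA.
  - rewrite -QN rmorph_prod; apply: eq_bigr => i _.
    rewrite rmorphXn /= comp_polyB comp_polyX comp_polyC; congr (_ ^+ _).
    by rewrite addnS -addSn natrD polyCD; ring.
rewrite /local_inverse; set E : rat := (-1) ^+ _.
set A := two_point_poly u 0; set B := two_point_poly _ 0.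
have -> : Q u * (E *: (Q (D - u)%N \Po - 'X)) * (A * (E *: (B \Po - 'X))) - 1
  = (E * E) *: ((Q u * A - 1) * ((Q (D - u)%N * B) \Po - 'X))
    + (E * E) *: ((Q (D - u)%N * B) \Po - 'X) - 1.
  by rewrite comp_polyM -!mul_polyC; ring.
have -> : E * E = 1 by rewrite /E -signr_odd; case: odd; rewrite ?mulrNN mulr1.
rewrite !scale1r -addrA dvdp_add //; first by rewrite dvdp_mulr // two_point_poly_inv.
have -> : (1 : {poly rat}) = 1 \Po - 'X by rewrite comp_polyC.
rewrite -comp_polyB.
have := dvdp_comp_poly (- 'X) (two_point_poly_inv (D - u)).
rewrite rmorphXn /= comp_polyX.
have -> : (- 'X : {poly rat}) ^+ r.+1 = (-1) ^+ r.+1 *: 'X^(r.+1) by rewrite -exprZn scaleN1r.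
by rewrite dvdpZl // signr_eq0.
Qed.
End Assembly.

(** With c = r + 1 the right-hand side has the shape of the sums over p, a, b in V: R^p scales by
    (r+1)^p and shifts the codimension by p, as the substitution z = (r+1)X does. *)
Lemma coef_comp_scale_triple (R : comNzRingType) (A B Q : {poly R}) (r K : nat) (c : R) :
  (size B <= K)%N ->
  (A * (B \Po (c *: 'X)) * Q)`_r
    = \sum_(p < K) \sum_(x < r.+1) \sum_(v < r.+1)
        B`_p * (c ^+ p * (x + p == v)%N%:R) * A`_x * Q`_(r - v).
Proof.
move=> BK.
have -> : B \Po (c *: 'X) = \sum_(p < K) (B`_p * c ^+ p) *: 'X^p.
  have {1}-> : B = \poly_(p < K) B`_p.
    apply/polyP => i; rewrite coef_poly; case: ltnP => // Ki.
    by rewrite nth_default // (leq_trans BK).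
  rewrite poly_def raddf_sum /=; under eq_bigr do
    rewrite comp_polyZ rmorphXn /= comp_polyX exprZn scalerA.
  by [].
rewrite mulr_sumr mulr_suml coef_sum; apply: eq_bigr => p _.
rewrite -scalerAr -scalerAl coefZ -[A * _ * Q]mulrA coefM [LHS]mulr_sumr; apply: eq_bigr => x _.
rewrite coefXnM; case: ltnP => xp.
  rewrite mulr0 mulr0 big1 // => v _.
  rewrite (_ : (x + p == v)%N = false) ?mulr0 ?mul0r //.
  by apply/eqP; have := ltn_ord v; lia.
have xpr : (x + p < r.+1)%N by have := ltn_ord x; lia.
rewrite (bigD1 (Ordinal xpr)) //= eqxx big1 ?addr0 => [|v vx].
  by rewrite subnDA mulr1 mulrA.
rewrite (_ : (x + p == v)%N = false) ?mulr0 ?mul0r //.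
by apply: contraNF vx => /eqP h; apply/eqP/val_inj.
Qed.

Lemma signz_exponent (x y : nat) :
  (-1) ^ (1 - x%:Z - y%:Z) = - ((-1) ^+ x * (-1) ^+ y) :> rat.
Proof.
by rewrite !expfzDr // expr1z -!exprnN !invr_sign !mulNr mul1r.
Qed.

(** * Column operations on V, and its rows as sums of residues *)

Section Columns.
Variables (r : nat) (M : moduli_data).
Hypothesis hr : (1 <= r)%N.
Hypothesis hM : stable_maps_axioms r M.
Variables (b : nat -> 'I_r.+1) (e : nat -> int).
Hypothesis be_diff : forall j k : nat,
  r.+1%:Z * e k + j%:Z + (b j)%:Z = r.+1%:Z * e j + k%:Z + (b k)%:Z.

Let eps j := `|e j - e 0%N|%N.

Lemma e_mono j k : (j <= k)%N -> e j <= e k.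
Proof.
move=> jk; have := be_diff j k; have := ltn_ord (b j); have := ltn_ord (b k).
nia.
Qed.

Lemma epsE j : e j = e 0%N + (eps j)%:Z.
Proof. by have := e_mono (leq0n j); rewrite /eps; lia. Qed.

(** As j + b_j - (r+1) e_j is constant, b_j counts down cyclically and e_j grows at each wrap from 0
    to r. *)
Lemma be_step j :
  (((b j.+1).+1 = b j :> nat) /\ eps j.+1 = eps j)
  \/ ((b j = 0%N :> nat) /\ (b j.+1 = r :> nat) /\ eps j.+1 = (eps j).+1).
Proof.
have := be_diff j j.+1; have := ltn_ord (b j); have := ltn_ord (b j.+1).
rewrite (epsE j) (epsE j.+1) => h1 h2 h3.
have [h|h] : (eps j.+1)%:Z = eps j \/ (eps j.+1)%:Z = (eps j).+1 by nia.
  by left; nia.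
by right; nia.
Qed.

Definition shifted_two_point_poly j u : {poly rat} :=
  if (u < eps j)%N then 0 else two_point_poly r M (u - eps j) (r - b j).

(** The two cases of [be_step] match those of [two_point_poly_rec]: passing from j to j + 1
    multiplies by X + u - eps_j modulo X^(r+1). *)
Lemma shifted_two_point_polyE j u :
  'X^(r.+1) %| shifted_two_point_poly j u
    - (column_poly r (b 0%N) eps j \Po ('X + (u%:R)%:P)) * two_point_poly r M u 0.
Proof.
elim: j => [|j IH].
  rewrite /shifted_two_point_poly {1 2}/eps subrr absz0 ltn0 subn0.
  rewrite /column_poly big_ord0 mulr1 rmorphXn /= comp_polyX.
  exact: (two_point_poly_exp hr hM) (leq_subr _ _).
set S := shifted_two_point_poly in IH *; set T := two_point_poly r M u 0 in IH *.
set Y := 'X + (u%:R)%:P in IH *.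
have -> : column_poly r (b 0%N) eps j.+1 \Po Y
  = (column_poly r (b 0%N) eps j \Po Y) * (Y - ((eps j)%:R)%:P).
  by rewrite /column_poly big_ord_recr /= mulrA comp_polyM comp_polyB comp_polyX comp_polyC.
set C := _ \Po _ in IH *.
have -> : S j.+1 u - C * (Y - ((eps j)%:R)%:P) * T
  = (Y - ((eps j)%:R)%:P) * (S j u - C * T) - ((Y - ((eps j)%:R)%:P) * S j u - S j.+1 u).
  by ring.
apply: dvdp_sub; first exact: dvdp_mull.
rewrite /S /shifted_two_point_poly.
case: (ltnP u (eps j)) => ue.
  rewrite ifT ?mulr0 ?subr0 ?dvdp0 //.
  by case: (be_step j) => [[_ ->]|[_ [_ ->]]] //; lia.
have -> : Y - ((eps j)%:R)%:P = 'X + ((u - eps j)%:R)%:P :> {poly rat}.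
  by rewrite natrB // polyCB addrA.
have := two_point_poly_rec hr hM (u - eps j) (leq_subr (b j) r).
case: (be_step j) => [[b1 ->]|[b0 [b1 ->]]].
  rewrite ifT; last by have := ltn_ord (b j); lia.
  rewrite ltnNge ue /= (_ : (r - b j).+1 = r - b j.+1)%N //.
  by have := ltn_ord (b j); lia.
rewrite b0 b1 subn0 ltnn subnn ltnS.
(* At u = eps_j the degree drops from 0 to a negative value, and both expressions are 0. *)
case: (ltngtP u (eps j)) ue => // [h|->] _; last by rewrite subnn.
by rewrite (_ : (u - eps j = (u - (eps j).+1).+1)%N) //; lia.
Qed.

Lemma gw2_dot0_shifted j v (u : nat) :
  gw2_dot M 0 v (dual (b j)) (e 0%N + u%:Z - e j) = (shifted_two_point_poly j u)`_(r - v).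
Proof.
have := ltn_ord v; rewrite ltnS => vr.
rewrite /shifted_two_point_poly [e j]epsE; case: ltnP => ue.
  by rewrite coef0 gw2_dot0_neg //; lia.
have -> : e 0%N + u%:Z - (e 0%N + (eps j)%:Z) = (u - eps j)%N%:Z by lia.
rewrite (gw2_dot0E hr hM) coef_poly ltnS leq_subr subKn //.
Qed.

Lemma gw2_dot_neg i (x y : 'I_r.+1) f : f < 0 -> gw2_dot M i x y f = 0.
Proof.
elim: i x y f => [|i IH] x y f f0; first exact: gw2_dot0_neg.
have cr : ((i.+1 + y) %% r.+1 < r.+1)%N by rewrite ltn_mod.
rewrite (@gw2_dot_succ r M hr hM i x y (Ordinal cr) f ((i.+1 + y) %/ r.+1)%N) /=; last first.
  by rewrite mulnC -divn_eq.
by rewrite IH // gw2_dot0_neg ?mulr0 ?subr0 // (le_lt_trans _ f0) // gerBl.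
Qed.

(** These are the coefficients left by unwinding the recursion of the corrected numbers; the double
    [dual] is what [gw2_dot_succ] produces for c = [dual (b t)]. *)
Definition column_change (t j : nat) : rat :=
  if t == j then 1 else if (j < t)%N then
    - gw2_dot M (t - j).-1 (dual (dual (b t))) (dual (b j)) (e t - e j)
  else 0.

Lemma gw2_dot_columns N (j : 'I_N) v x :
  gw2_dot M (N - 1 - j) v (dual (b j)) (x - e j)
    = \sum_(t < N) column_change t j * gw2_dot M 0 v (dual (b t)) (x - e t).
Proof.
have aux i : gw2_dot M i v (dual (b j)) (x - e j) = \sum_(t < i.+1)
    column_change (t + j) j * gw2_dot M 0 v (dual (b (t + j)%N)) (x - e (t + j)%N).
  elim: i => [|i IH].
    by rewrite big_ord1 /column_change add0n eqxx mul1r.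
  have ej : e j <= e (i.+1 + j)%N by apply: e_mono; rewrite leq_addl.
  rewrite big_ord_recr /= -IH.
  (* By [be_diff] this class and this degree are the remainder and the quotient required, so level i
     + 1 subtracts a multiple of the uncorrected column i + 1 + j. *)
  rewrite (@gw2_dot_succ r M hr hM i v (dual (b j)) (dual (b (i.+1 + j)%N)) _
             `|e (i.+1 + j)%N - e j|%N).
    congr (_ + _); rewrite /column_change ifF; last by apply/eqP; lia.
    rewrite ifT; last by lia.
    rewrite mulNr addnK /= gez0_abs ?subr_ge0 //; congr (- (_ * gw2_dot _ _ _ _ _)).
    by ring.
  have := be_diff j (i.+1 + j)%N; rewrite /dual /= !subSS.
  have := ltn_ord (b j); have := ltn_ord (b (i.+1 + j)%N); nia.
have jN := ltn_ord j; rewrite aux.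
rewrite -(big_mkord xpredT (fun t => column_change t j * gw2_dot M 0 v (dual (b t)) (x - e t))).
rewrite (@big_cat_nat _ _ _ j) //=; last by lia.
rewrite [X in _ = X + _]big_nat [X in _ = X + _]big1 ?add0r => [|t /andP[_ tj]]; last first.
  by rewrite /column_change ltn_eqF // ltnNge (ltnW tj) mul0r.
have := big_addn 0 N j xpredT
  (fun t => column_change t j * gw2_dot M 0 v (dual (b t)) (x - e t)) (idx := 0) (op := +%R).
rewrite add0n => ->; rewrite big_mkord.
by rewrite (_ : (N - 1 - j).+1 = N - j)%N //; lia.
Qed.

(** A row of V as a linear functional of its two-point factor, so that column operations pass
    through it; the summation index is u = e - e_0. *)
Definition Vrow (k D : nat) (G : 'I_r.+1 -> nat -> rat) : rat :=
  \sum_(p < k.+2) \sum_(u < D.+1) \sum_(x < r.+1) \sum_(v < r.+1)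
    (-1) ^ (1 - x%:Z - (D - u)%N%:Z * r.+1%:Z)
    * bracket ((3%:R - r%:R) / 2%:R - (D - u)%N%:R * r.+1%:R) k p
    * Rpow p x v * gw1_dot M (dual x) (D - u)%N%:Z * G v u.

Lemma Vrow_sum k D N (c : 'I_N -> rat) (G : 'I_N -> 'I_r.+1 -> nat -> rat) :
  Vrow k D (fun v u => \sum_(t < N) c t * G t v u) = \sum_(t < N) Vrow k D (G t) * c t.
Proof.
rewrite /Vrow; under [RHS]eq_bigr do rewrite mulr_suml.
rewrite [RHS]exchange_big; apply: eq_bigr => p _.
under [RHS]eq_bigr do rewrite mulr_suml.
rewrite [RHS]exchange_big; apply: eq_bigr => u _.
under [RHS]eq_bigr do rewrite mulr_suml.
rewrite [RHS]exchange_big; apply: eq_bigr => x _.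
under [RHS]eq_bigr do rewrite mulr_suml.
rewrite [RHS]exchange_big; apply: eq_bigr => v _.
by rewrite mulr_sumr; apply: eq_bigr => t _; ring.
Qed.

(** One-point invariants vanish for e > d, and two-point numbers for e < e_j, hence for e < e_0. *)
Lemma VcoefE g n m a N d j : e 0%N <= d ->
  Vcoef M g n m a b e N d j
    = Vrow `|kdeg r g n m a d|%N `|d - e 0%N|%N
        (fun v u => gw2_dot M (N - 1 - j) v (dual (b j)) (e 0%N + u%:Z - e j)).
Proof.
move=> ed; rewrite /Vcoef /Vrow; apply: eq_bigr => p _.
rewrite (@fsbig_int_window _ (e 0%N) `|d - e 0%N|%N); last first.
  move=> x hx; apply: big1 => y _; apply: big1 => z _.
  case: hx => hx; last by rewrite gw1_dot_neg ?mulr0 ?mul0r //; lia.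
  by rewrite gw2_dot_neg ?mulr0 //; have := e_mono (leq0n j); lia.
apply: eq_bigr => u _; apply: eq_bigr => x _; apply: eq_bigr => v _.
have -> : d - (e 0%N + u%:Z) = (`|d - e 0%N| - u)%N%:Z by have := ltn_ord u; lia.
by rewrite -pmulrn.
Qed.

Lemma Vrow_residue k D j : (k.+1 = r.+1 * D + b 0%N)%N ->
  Vrow k D (fun v u => gw2_dot M 0 v (dual (b j)) (e 0%N + u%:Z - e j))
    = - r.+1%:R ^+ k.+1
      * residue_oo (bracket_poly r (b 0%N) D * column_poly r (b 0%N) eps j) (pole_poly r D).
Proof.
move=> kD.
rewrite /pole_poly -(sum_residues (x := fun u : 'I_D.+1 => u%:R) (inv := local_inverse r M D)).
- rewrite /Vrow exchange_big mulr_sumr; apply: eq_bigr => u _.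
  pose y : rat := (3%:R - r%:R) / 2%:R - (D - u)%N%:R * r.+1%:R.
  pose B : {poly rat} := \prod_(i < k.+1) ('X + (y + i%:R)%:P).
  (* The signs (-1)^a are absorbed by replacing X by -X in the one-point generating function. *)
  pose A : {poly rat} := (-1) ^+ (r.+1 * (D - u)) *: (two_point_poly r M (D - u) 0 \Po - 'X).
  have sB : (size B <= k.+2)%N.
    rewrite /B (eq_bigr (fun i : 'I_k.+1 => 'X - (- (y + i%:R))%:P)).
      by rewrite size_prod_XsubC /index_enum -enumT size_enum_ord.
    by move=> i _; rewrite polyCN opprK.
  transitivity (- (A * (B \Po (r.+1%:R *: 'X)) * shifted_two_point_poly j u)`_r).
    rewrite (coef_comp_scale_triple _ _ _ _ sB) -sumrN; apply: eq_bigr => p _.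
    rewrite -sumrN; apply: eq_bigr => x _; rewrite -sumrN; apply: eq_bigr => v _.
    rewrite gw2_dot0_shifted (gw1_dotE hr hM) -PoszM signz_exponent /A coefZ coef_comp_polyNX.
    rewrite coef_poly ltn_ord /Rpow /bracket /dual /= subSS mulnC -/y -/B; ring.
  have BE : B \Po (r.+1%:R *: 'X)
    = r.+1%:R ^+ k.+1 *: (bracket_poly r (b 0%N) D \Po ('X + (u%:R)%:P)).
    rewrite /B /bracket_poly -kD !rmorph_prod /= -[RHS]mul_polyC polyC_exp.
    have -> : (r.+1%:R)%:P ^+ k.+1 = \prod_(i < k.+1) (r.+1%:R)%:P :> {poly rat}.
      by rewrite prodr_const card_ord.
    rewrite -big_split /=; apply: eq_bigr => i _.
    rewrite !comp_polyD !comp_polyC rmorphN /= !comp_polyX comp_polyC -mul_polyC.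
    have -> : y + i%:R
      = r.+1%:R * (u%:R - D%:R + ((3%:R - r%:R) / 2%:R + i%:R) / r.+1%:R).
      rewrite /y natrB; last by rewrite -ltnS.
      by field; rewrite addrC natr1 pnatr_eq0.
    by rewrite polyCM !polyCD polyCN; ring.
  rewrite BE -scalerAr -scalerAl coefZ mulNr; congr (- (_ * _)).
  (* Only the coefficient of X^r is read off, so a congruence modulo X^(r+1) suffices. *)
  have h := shifted_two_point_polyE j u.
  have {h} := dvdXn_coef0 (dvdp_mulr (A * (bracket_poly r (b 0%N) D \Po ('X + (u%:R)%:P))) h)
                (ltnSn r).
  rewrite mulrBl coefB => /eqP; rewrite subr_eq0 => /eqP h.
  rewrite mulrC h; congr (_`_r); congr polyseq.
  rewrite [bracket_poly _ _ _ * _ \Po _]comp_polyM /local_inverse -/A; ring.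
- by move=> u v /eqP; rewrite eqr_nat => /eqP h; apply: val_inj.
- by move=> u; apply: (local_inverseP hr hM).
Qed.

End Columns.

Theorem proposition3p1 (r g n : nat) (hr : (1 <= r)%N) (hg : (1 <= g)%N)
    (hn : (1 <= n)%N) (m a : nat -> nat)
    (ha : forall i : nat, (2 <= i <= n)%N -> (a i <= r)%N)
    (M : moduli_data) (hM : stable_maps_axioms r M)
    (b : nat -> 'I_r.+1) (e : nat -> int) (hbe : is_be g n m a b e)
    (delta : int) (hdelta : is_delta r g n m a delta)
    (N : nat) (hN : (1 <= N)%N)
    (d : 'I_N -> int) (d_inj : injective d) (hd : forall i : 'I_N, delta <= d i) :
  \det (\matrix_(i < N, j < N) Vcoef M g n m a b e N (d i) j) != 0.
Proof.
have be_diff j k : r.+1%:Z * e k + j%:Z + (b j)%:Z = r.+1%:Z * e j + k%:Z + (b k)%:Z.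
  by have := hbe j; have := hbe k; lia.
(* The equation for j = 0 eliminates g, n and the sum; as b_0 <= r, positivity of k(d) then forces d
   >= e_0. *)
have kdegE x : kdeg r g n m a x = r.+1%:Z * (x - e 0%N) + (b 0%N)%:Z - 1.
  by have := hbe 0%N; rewrite /kdeg; lia.
have d_pos i : 0 < kdeg r g n m a (d i).
  by have := hd i; have := hdelta.1; rewrite !kdegE; nia.
have e_d i : e 0%N <= d i by have := d_pos i; rewrite kdegE; have := ltn_ord (b 0%N); nia.
pose D i := `|d i - e 0%N|%N; pose k i := `|kdeg r g n m a (d i)|%N.
have kD i : ((k i).+1 = r.+1 * D i + b 0%N)%N.
  by have := d_pos i; have := e_d i; rewrite /k /D kdegE; lia.
pose eps j := `|e j - e 0%N|%N.
have b0r : (b 0%N <= r)%N by rewrite -ltnS.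
have [w sw wE] : exists2 w : nat -> {poly rat}, forall j, size (w j) = j.+1 & forall j x,
    residue_oo (bracket_poly r (b 0%N) x * column_poly r (b 0%N) eps j) (pole_poly r x)
      = (w j).[x%:R].
  have [w wP] := choice (fun j => residue_oo_column_poly b0r eps j).
  by exists w => j; [have [] := wP j | move=> x; have [_ ->] := wP j].
(* V factors into a diagonal matrix of signed powers of r + 1, the values of polynomials of degree
   j, and a unitriangular matrix. *)
have -> : \matrix_(i < N, j < N) Vcoef M g n m a b e N (d i) j
  = diag_mx (\row_i (- r.+1%:R ^+ (k i).+1)) *m \matrix_(i < N, j < N) (w j).[(D i)%:R]
    *m \matrix_(i < N, j < N) column_change M b e i j.
  apply/matrixP => i j; rewrite [LHS]mxE [RHS]mxE VcoefE //.
  transitivity (Vrow M (k i) (D i) (fun v u => \sum_(t < N) column_change M b e t j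
      * gw2_dot M 0 v (dual (b t)) (e 0%N + u%:Z - e t))).
    congr Vrow; apply/funext => v; apply/funext => u.
    exact: (gw2_dot_columns hr hM be_diff).
  rewrite Vrow_sum; apply: eq_bigr => t _.
  by rewrite mul_diag_mx !mxE (Vrow_residue hr hM be_diff _ (kD i)) wE.
rewrite !det_mulmx det_diag !mulf_neq0 //.
- by apply/prodf_neq0 => i _; rewrite !mxE oppr_eq0 expf_neq0 // pnatr_eq0.
- apply: (det_poly_neq0 sw) => i i' /eqP.
  rewrite eqr_nat => /eqP DD; apply: d_inj; move: DD (e_d i) (e_d i'); rewrite /D; lia.
- rewrite det_trig.
    by apply/prodf_neq0 => i _; rewrite mxE /column_change eqxx oner_eq0.
  apply/is_trig_mxP => i j ij.
  by rewrite mxE /column_change ltn_eqF // ltnNge ltnW.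
Qed.
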